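(* Assume that the Markov renewal kernel $q$ is strict. For every initial law concentrated on $\mathcal E$, the augmented field $Y=(Y_k)_{k\in\mathbb N^d}$, $Y_k=(Z_k,U_k)$, satisfies $$\mathbb E\left[f(Y_{k+h})\mid\mathcal G_k^Y\right]=R_hf(Y_k),\qquad k,h\in\mathbb N^d,$$ for every bounded measurable function $f$ on $\mathcal E$, where $\mathcal G_k^Y=\sigma\{Y_m:m\leq_dk\}$. Moreover, $(R_h)_{h\in\mathbb N^d}$ is a Markov semigroup on $\mathcal E$: $$R_{0_d}=I,\qquad R_{h+r}=R_hR_r,\qquad h,r\in\mathbb N^d.$$ In particular, the coordinate transition kernels $R_{e_1},\dots,R_{e_d}$ commute, where $e_i$ is the $i$-th coordinate vector.
   Context: Notation: $\mathbb N=\{0,1,2,\dots\}$, $d\ge1$; $r\leq_dk$ means $r_j\le k_j$ for all $j$, and $r\not\leq_dk$ its negation; $0_d$ is the zero vector. $(\mathsf X,\mathcal X)$ is a standard Borel space and $q=(q_k)_{k\in\mathbb N^d}$ is a family of non-negative kernels on $\mathsf X$ with $\sum_kq_k(x,\mathsf X)=1$ for all $x$; it is strict if $q_{0_d}=0$. The Markov renewal chain $(J_n,S_n)$ with kernel $q$ satisfies $\mathbb P(J_{n+1}\in A,S_{n+1}-S_n=k\mid J_0,S_0,\dots,J_n,S_n)=q_k(J_n,A)$; under $\mathbb P_y$ it starts from $J_0=y$, $S_0=0_d$. For $k\in\mathbb N^d$: $N(k)=\sup\{n\ge0:S_n\leq_dk\}$, $Z_k=J_{N(k)}$, $U_k=k-S_{N(k)}$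 (backward recurrence vector). For $u\in\mathbb N^d$, $\overline H_u(x)=\sum_{v\not\leq_du}q_v(x,\mathsf X)$; $\mathcal E=\{(x,u)\in\mathsf X\times\mathbb N^d:\overline H_u(x)>0\}$; for $(x,u)\in\mathcal E$ the residual kernel is $q^{\langle u\rangle}_v(x,A)=\mathbf 1_{\{v\not\leq_du\}}q_v(x,A)/\overline H_u(x)$. Field started from $(x,u)\in\mathcal E$: put $J_0=x$, $S_0=-u$ (the last renewal epoch is $-u$), let $(J_1,S_1-S_0)$ have law $q^{\langle u\rangle}_v(x,dy)$ on pairs $(y,v)$, let all later transitions be governed by $q$, and define $N(k),Z_k,U_k$ by the same formulas (so $Y_{0_d}=(x,u)$). For a general initial law on $\mathcal E$, $Y_{0_d}$ has that law. For $t\in\mathbb N^d$, $K_t((y,0_d),B)=\mathbb P_y((Z_t,U_t)\in B)$. For $(x,u)\in\mathcal E$ and $h\in\mathbb N^d$, $$R_h((x,u),B)=\frac{\overline H_{u+h}(x)}{\overline H_u(x)}\mathbf 1_B(x,u+h)+\frac1{\overline H_u(x)}\sum_{v\leq_du+h,\; v\not\leq_du}\int_{\mathsf X}q_v(x,dy)K_{u+h-v}((y,0_d),B).$$ *)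

(* Defs.v *)
From HB Require Import structures.
From mathcomp Require Import all_boot all_order all_algebra.
From mathcomp Require Import all_classical all_reals all_analysis.
From mathcomp Require Import measurable_realfun.

Set Implicit Arguments.
Unset Strict Implicit.
Unset Printing Implicit Defensive.

Import Order.TTheory GRing.Theory Num.Theory.
Import numFieldNormedType.Exports.

Local Open Scope classical_set_scope.
Local Open Scope ring_scope.

(* N^d and Z^d, both with the discrete sigma-algebra.  Z^d is needed because a
   field started from (x, u) has its zeroth renewal epoch at -u. *)
Definition nvec (d : nat) : Type := {ffun 'I_d -> nat}.
Definition zvec (d : nat) : Type := {ffun 'I_d -> int}.

HB.instance Definition _ (d : nat) := Choice.on (nvec d).
HB.instance Definition _ (d : nat) := GRing.Nmodule.on (nvec d).
HB.instance Definition _ (d : nat) := isPointed.Build (nvec d) 0.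
HB.instance Definition _ (d : nat) :=
  @isMeasurable.Build default_measure_display (nvec d)
    discrete_measurable discrete_measurable0
    discrete_measurableC discrete_measurableU.

HB.instance Definition _ (d : nat) := Choice.on (zvec d).
HB.instance Definition _ (d : nat) := GRing.Zmodule.on (zvec d).
HB.instance Definition _ (d : nat) := isPointed.Build (zvec d) 0.
HB.instance Definition _ (d : nat) :=
  @isMeasurable.Build default_measure_display (zvec d)
    discrete_measurable discrete_measurable0
    discrete_measurableC discrete_measurableU.

Definition nle (d : nat) (r k : nvec d) : bool := [forall j, (r j <= k j)%N].
Definition zle (d : nat) (r k : zvec d) : bool := [forall j, r j <= k j].

Definition nsub (d : nat) (k r : nvec d) : nvec d := [ffun j => (k j - r j)%N].
Definition unit_vec (d : nat) (i : 'I_d) : nvec d := [ffun j => nat_of_bool (j == i)].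

Definition zvec_of (d : nat) (k : nvec d) : zvec d := [ffun j => (k j)%:Z].
(* Inverse of [zvec_of] on vectors with nonnegative coordinates; only its values
   there matter. *)
Definition nvec_of (d : nat) (s : zvec d) : nvec d := [ffun j => `|s j|%N].

(* The Borel sigma-algebra of some Polish space, transported along a bijection.
   A Hausdorff pseudometric is a metric. *)
Definition standard_borel (R : realType) (dX : measure_display)
    (X : measurableType dX) : Prop :=
  exists (T : completePseudoMetricType R) (g : X -> T),
    [/\ hausdorff_space T,
        exists2 D : set T, countable D & dense D,
        bijective g &
        (@measurable dX X) = preimage_set_system setT g <<s @open T >>].

Section ConditionalExpectation.
Context (dO : measure_display) (Omega : measurableType dO) (R : realType).
Local Open Scope ereal_scope.

(* V is a version of E[W | G], for W integrable. *)
Definition is_cond_exp (P : probability Omega R) (G : set (set Omega))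
    (W V : Omega -> \bar R) : Prop :=
  [/\ G `<=` measurable,
      P.-integrable setT W,
      P.-integrable setT V,
      forall B : set (\bar R), measurable B -> G (V @^-1` B) &
      forall A, G A -> \int[P]_(w in A) V w = \int[P]_(w in A) W w].

Definition sigma_generated (I : Type) (D : set I) (dT : measure_display)
    (T : measurableType dT) (Y : I -> Omega -> T) : set (set Omega) :=
  <<s \bigcup_(i in D) preimage_set_system setT (Y i) measurable >>.

End ConditionalExpectation.

Section Processes.
Context (d : nat) (R : realType) (dX : measure_display) (X : measurableType dX).
Context (q : nvec d -> R.-ker X ~> X).
Local Open Scope ereal_scope.

Definition total_mass_one : Prop :=
  forall x : X, \esum_(k in [set: nvec d]) q k x setT = 1.

Definition strict_kernel : Prop :=
  forall (x : X) (A : set X), measurable A -> q 0%R x A = 0.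

Definition Hbar (u : nvec d) (x : X) : \bar R :=
  \esum_(v in [set v : nvec d | ~~ nle v u]) q v x setT.

Definition admissible : set (X * nvec d) := [set z | 0 < Hbar z.2 z.1].

Definition residual (u v : nvec d) (x : X) (A : set X) : \bar R :=
  if nle v u then 0 else q v x A / Hbar u x.

Context (dO : measure_display) (Omega : measurableType dO).

Section Path.
Context (J : nat -> Omega -> X) (S : nat -> Omega -> zvec d).

(* The supremum is 0 by convention when the set is unbounded, which for a strict
   kernel happens with probability zero. *)
Definition last_renewal (k : nvec d) (w : Omega) : nat :=
  supremum 0%N [set n : nat | zle (S n w) (zvec_of k)].

Definition current_state (k : nvec d) (w : Omega) : X :=
  J (last_renewal k w) w.

Definition backward_rec (k : nvec d) (w : Omega) : nvec d :=
  nvec_of (zvec_of k - S (last_renewal k w) w)%R.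

Definition augmented (k : nvec d) (w : Omega) : X * nvec d :=
  (current_state k w, backward_rec k w).

Definition history (n : nat) : set (set Omega) :=
  sigma_generated [set m : nat | (m <= n)%N] (fun m w => (J m w, S m w)).

Definition past (k : nvec d) : set (set Omega) :=
  sigma_generated [set m : nvec d | nle m k] augmented.

Definition jump_event (n : nat) (k : nvec d) (A : set X) : set Omega :=
  [set w | A (J n.+1 w) /\ (S n.+1 w - S n w)%R = zvec_of k].

(* P(J_{n+1} in A, S_{n+1} - S_n = k | J_0, S_0, ..., J_n, S_n)
     = kern (J_n, S_n) k A  for all k and A. *)
Definition transition_at (P : probability Omega R) (n : nat)
    (kern : X * zvec d -> nvec d -> set X -> \bar R) : Prop :=
  forall (k : nvec d) (A : set X), measurable A ->
    is_cond_exp P (history n)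
      (fun w => (\1_(jump_event n k A) w)%:E)
      (fun w => kern (J n w, S n w) k A).

Definition measurable_path : Prop :=
  forall n, measurable_fun setT (J n) /\ measurable_fun setT (S n).

Definition initial_law (P : probability Omega R)
    (nu : set (X * zvec d) -> \bar R) : Prop :=
  forall C : set (X * zvec d), measurable C ->
    P [set w | C (J 0%N w, S 0%N w)] = nu C.

(* The Markov renewal chain with kernel q, under P_y. *)
Definition renewal_chain_from (P : probability Omega R) (y : X) : Prop :=
  [/\ measurable_path,
      initial_law P (fun C => \d_(y, 0%R : zvec d) C) &
      forall n, transition_at P n (fun z k A => q k z.1 A)].

(* The chain underlying the field with initial law mu: (J_0, -S_0) has law mu,
   the first step from (x, -u) follows the residual kernel q^<u>, the later
   ones follow q. *)
Definition delayed_chain (P : probability Omega R)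
    (mu : set (X * nvec d) -> \bar R) : Prop :=
  [/\ measurable_path,
      initial_law P
        (fun C => mu [set z | C (z.1, (- zvec_of z.2)%R)]),
      transition_at P 0
        (fun z v A => residual (nvec_of (- z.2)%R) v z.1 A) &
      forall n, (0 < n)%N -> transition_at P n (fun z k A => q k z.1 A)].

(* K_t((y, 0_d), B), P being the family of laws (P_y)_y. *)
Definition Kker (P : X -> probability Omega R) (t : nvec d) (y : X)
    (B : set (X * nvec d)) : \bar R :=
  P y (augmented t @^-1` B).

Definition Rker (P : X -> probability Omega R) (h : nvec d) (z : X * nvec d)
    (B : set (X * nvec d)) : \bar R :=
  let: (x, u) := z in
  Hbar (u + h)%R x / Hbar u x * (\1_B (x, (u + h)%R))%:E
  + (Hbar u x)^-1 *
    \esum_(v in [set v : nvec d | nle v (u + h)%R && ~~ nle v u])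
      \int[q v x]_y Kker P (nsub (u + h)%R v) y B.

End Path.
End Processes.

Section KernelsOnASubset.
Context (dT : measure_display) (T : measurableType dT) (R : realType).
Context (E : set T).
Local Open Scope ereal_scope.

Definition markov_kernel_on (k : T -> set T -> \bar R) : Prop :=
  (forall z, E z -> exists m : probability T R,
     m E = 1 /\ forall B, measurable B -> k z B = m B) /\
  (forall B, measurable B -> measurable_fun E (fun z => k z B)).

Definition kernel_act (k : T -> set T -> \bar R) (f : T -> R) (z : T) : \bar R :=
  \int[k z]_(z' in E) (f z')%:E.

Definition kernel_comp (k l : T -> set T -> \bar R) (z : T) (B : set T) : \bar R :=
  \int[k z]_(z' in E) l z' B.

Definition kernel_eq_on (k l : T -> set T -> \bar R) : Prop :=
  forall z B, E z -> measurable B -> k z B = l z B.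

End KernelsOnASubset.

(* Main.v *)
(* Write K_t g (y) = E_y[g(Y_t)] for the renewal chain and w_u(x) for Hbar.
   Summing over the number n of renewals up to t gives K g = sum_n Q^n (w g), where
   Q g (x, u) = sum_{v <= u} int q_v(x, dy) g(y, u - v), hence the renewal equation
   K g = w g + Q (K g).  Since the kernel is strict, induction on t turns this
   equation into K_t R_r = K_{t+r}; splitting the first jump v according to v <= u + h
   or not then yields R_h R_r = R_{h+r}.
   For the Markov property, decompose according to N(k) = n.  On this event a set of
   the past sigma-algebra coincides with a set H_n depending on the first n steps only.
   Conditioning on these steps, the indicator of N(k) = n produces a factor w_u(x),
   with (x, u) = Y_k, and the future contributes w_u(x) R_h g (x, u): either the next
   jump leaves k + h as well, or it lands between k and k + h and K takes over.  For
   n = 0 the residual kernel only multiplies both sides by the same factor. *)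
Require Import Defs.
From HB Require Import structures.
From mathcomp Require Import all_boot all_order all_algebra.
From mathcomp Require Import all_classical all_reals all_analysis.
From mathcomp Require Import measurable_realfun.
From mathcomp Require Import zify.

Set Implicit Arguments.
Unset Strict Implicit.
Unset Printing Implicit Defensive.

Import Order.TTheory GRing.Theory Num.Theory.
Import numFieldNormedType.Exports.

Local Open Scope classical_set_scope.
Local Open Scope ring_scope.

(** The chain is known only through conditional probabilities of jump events given its history, and
    its path is increasing only almost surely. Every probabilistic statement is therefore an
    identity between integrals of [0, +oo]-valued functions over sets of the history; a signed f is
    cut into positive and negative parts only at the very end. To avoid dividing by [Hbar] where it
    vanishes, R_h is handled through its numerator [jump]: a function f counts as R_h g as soon as
    [Hbar] times f equals [jump] of g. This leaves f free off the admissible set, so that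
    restrictions to that set cost nothing. Residual and ordinary steps are unified by writing a step
    kernel as a factor c times q_v, with c = 1 for ordinary steps. [Rker] is a bare set function
    built from the laws P_y. That it is a measure comes from its operator form, in which K is the
    series [green] and, at the same time, an integral against P_y. *)

HB.instance Definition _ (d : nat) := Countable.on (nvec d).
HB.instance Definition _ (d : nat) := Countable.on (zvec d).

Local Open Scope ereal_scope.

(** * Countable sums of nonnegative functions *)

(** The series runs over codes; a number that encodes nothing decodes to [None] and contributes 0.
    In this form the series theorems for integrals apply to sums over N^d and Z^d. *)
Lemma esum_nneseries (R : realType) (I : countType) (a : I -> \bar R) :
  (forall i, 0 <= a i) ->
  \esum_(i in [set: I]) a i = \sum_(n <oo) oapp a 0 (pickle_inv n).
Proof.
move=> a0; have b0 n : 0 <= oapp a 0 (@pickle_inv I n) by case: (@pickle_inv I n).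
rewrite nneseries_esumT; last exact: b0.
rewrite (esumID (range (@pickle I))) ?setTI; last first.
  by move=> n _; exact: b0.
rewrite [X in _ + X]esum1 ?adde0; last first.
  move=> n /= Hn; case E : (@pickle_inv I n) => [i|]; last exact: erefl.
  exfalso; apply: Hn; exists i; first exact: Logic.I.
  have := @pickle_invK I n; rewrite E /=; exact.
rewrite (esum_image setT (@pickle I)); last first.
  by move=> i j _ _; exact: (pcan_inj (@pickleK_inv I)).
by apply: eq_esum => i _; rewrite (pickleK_inv i).
Qed.

Section ge0_measurable_ind.
Import HBNNSimple.

(* Every nonnegative measurable function is a countable sum of nonnegative
   multiples of indicators, so functionals that respect such sums are determined
   by their values on sets. *)
Lemma ge0_measurable_ind (dT : measure_display) (T : measurableType dT)
    (R : realType) (P : (T -> \bar R) -> Prop) :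
  (forall A (c : R), measurable A -> (0 <= c)%R ->
    P (fun x => c%:E * (\1_A x)%:E)) ->
  (forall g : nat -> T -> \bar R,
    (forall n, measurable_fun setT (g n)) -> (forall n x, 0 <= g n x) ->
    (forall n, P (g n)) -> P (fun x => \sum_(n <oo) g n x)) ->
  forall g, measurable_fun setT g -> (forall x, 0 <= g x) -> P g.
Proof.
move=> Pi Ps.
have P0 : P (cst 0).
  have := Pi set0 0%R measurable0 (lexx _).
  by congr P; apply/funext => x; rewrite mul0e.
have Psum (s : seq (R * set T)) :
    all (fun p => p.1 >= 0)%R s -> (forall p, p \in s -> measurable p.2) ->
    P (fun x => \sum_(p <- s) (p.1%:E * (\1_(p.2) x)%:E)).
  move=> /allP s0 ms.
  (* The finite sum is padded with zeros to a series, so that closure under series is the only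
     closure property required of [P]. *)
  pose g n x := if (n < size s)%N then
    (nth (0%R, set0) s n).1%:E * (\1_((nth (0%R, set0) s n).2) x)%:E
    else (0 : \bar R).
  have mg n : measurable_fun setT (g n).
    rewrite /g; case: (ltnP n (size s)) => sn; last exact: measurable_cst.
    apply: measurable_funeM; apply/measurable_EFinP/measurable_indic.
    by apply: ms; exact: mem_nth.
  have g0 n x : 0 <= g n x.
    rewrite /g; case: ifPn => sn //.
    by rewrite mule_ge0// lee_fin// s0// mem_nth.
  have := Ps _ mg g0; rewrite /g; have -> : (fun x => \sum_(n <oo) g n x) =
     (fun x => \sum_(p <- s) (p.1%:E * (\1_(p.2) x)%:E)).
    apply/funext => x; rewrite (@nneseries_split _ (g^~ x) 0 (size s) (fun k _ => g0 k x)) add0n.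
    rewrite (_ : \sum_(size s <= n <oo) g n x = 0) ?adde0; last first.
      by apply: eseries0 => n sn _; rewrite /g ltnNge sn.
    rewrite (big_nth (0%R, set0)) !big_mkord; apply: eq_bigr => i _.
    by rewrite /g ltn_ord.
  apply => n; case: (ltnP n (size s)) => sn; last exact: P0.
  by apply: Pi; [apply: ms; exact: mem_nth | apply: s0; exact: mem_nth].
have Pf (h : {nnsfun T >-> R}) : P (EFin \o h).
  pose s := [seq (r, h @^-1` [set r]) | r <- finmap.enum_fset (fset_set (range h))].
  have := Psum s; have -> : (fun x => \sum_(p <- s) (p.1%:E * (\1_(p.2) x)%:E)) = EFin \o h.
    apply/funext => x; rewrite big_map /= [in RHS](fimfunE h) fsbig_finite//=.
    by rewrite -sumEFin; apply: eq_bigr => r _; rewrite EFinM.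
  apply.
    by apply/allP => _ /mapP[r + ->] /=; rewrite in_fset_set// inE => -[x _ <-].
  by move=> _ /mapP[r _ ->] /=.
move=> g mg g0.
pose h := nnsfun_approx measurableT mg.
have ndh x : {homo h^~ x : m n / (m <= n)%N >-> (m <= n)%R}.
  by move=> m n mn; exact/lefP/nd_nnsfun_approx.
(* The increments of the increasing simple approximations are again nonnegative simple functions,
   and they telescope to [g]. *)
pose k n x := if n is n'.+1 then (h n'.+1 x - h n' x)%R else h 0%N x.
have k0 n x : (0 <= k n x)%R by case: n => [//|n] /=; rewrite subr_ge0 ndh.
have mk n : measurable_fun setT (k n).
  case: n => [|n]; first exact: measurable_funP.
  by apply: measurable_funB; exact: measurable_funP.
have Pk n : P (EFin \o k n).
  case: n => [|n]; first exact: Pf.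
  have fk : finite_set (range (k n.+1)).
    apply: (sub_finite_set (B := (fun p => p.1 - p.2)%R @`
      (range (h n.+1) `*` range (h n)))).
      by move=> _ [x _ <-]; exists (h n.+1 x, h n x) => //; split; exists x.
    by apply: finite_image; apply: finite_setX.
  pose kn : {nnsfun T >-> R} := HB.pack (k n.+1)
    (isMeasurableFun.Build _ _ _ _ _ (mk n.+1))
    (isNonNegFun.Build _ _ _ (k0 n.+1)) (FiniteImage.Build _ _ _ fk).
  exact: (Pf kn).
have := Ps (fun n => EFin \o k n); have -> : (fun x => \sum_(n <oo) (EFin \o k n) x) = g.
  apply/funext => x.
  apply/cvg_lim => //; rewrite -cvg_shiftS.
  rewrite [X in X @ _ --> _](_ : _ = EFin \o h^~ x).
    by apply: cvg_nnsfun_approx.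
  apply/funext => n /=.
  elim: n => [|n IH]; first by rewrite big_nat1.
  by rewrite big_nat_recr//= IH /= -EFinD addrC subrK.
apply => //= n; first exact/measurable_EFinP.
Qed.

End ge0_measurable_ind.

Lemma countType_pickle_inv_ge0 (R : realType) (I : countType) (a : I -> \bar R) n :
  (forall i, 0 <= a i) -> 0 <= oapp a 0 (@pickle_inv I n).
Proof. by move=> a0; case: (@pickle_inv I n). Qed.

Section esum_countType.
Context (R : realType) (I : countType).
Implicit Types (a : I -> \bar R).

(** The factor may be +oo, as 1 / [Hbar] is off the admissible set; passing to the integral against
    the counting measure allows this. *)
Lemma esumZl a (k : \bar R) : 0 <= k -> (forall i, 0 <= a i) ->
  \esum_(i in [set: I]) (k * a i) = k * \esum_(i in [set: I]) a i.
Proof.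
move=> k0 a0.
rewrite !esum_nneseries//; last by move=> i; rewrite mule_ge0.
have b0 := fun n => countType_pickle_inv_ge0 n a0.
rewrite -(ge0_integral_count (a := fun n => oapp a 0 (@pickle_inv I n)))//.
rewrite -ge0_integralZl// -ge0_integral_count//; last first.
  by move=> n; apply: countType_pickle_inv_ge0 => i; rewrite mule_ge0.
by apply: eq_integral => n _; case: (@pickle_inv I n) => //=; rewrite mule0.
Qed.

Lemma esum_nneseriesC (a : nat -> I -> \bar R) : (forall n i, 0 <= a n i) ->
  \esum_(i in [set: I]) \sum_(n <oo) a n i =
  \sum_(n <oo) \esum_(i in [set: I]) a n i.
Proof.
move=> a0; rewrite esum_nneseries; last by move=> i; exact: nneseries_ge0.
under [RHS]eq_eseriesr do rewrite esum_nneseries//.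
rewrite nneseries_interchange; last first.
  by move=> i j; exact: countType_pickle_inv_ge0.
apply: eq_eseriesr => n _; case: (@pickle_inv I n) => //=.
by rewrite eseries0.
Qed.

Context (dT : measure_display) (T : measurableType dT).

Lemma measurable_fun_esum (F : I -> T -> \bar R) : (forall i x, 0 <= F i x) ->
  (forall i, measurable_fun setT (F i)) ->
  measurable_fun setT (fun x => \esum_(i in [set: I]) F i x).
Proof.
move=> F0 mF.
have -> : (fun x => \esum_(i in [set: I]) F i x) =
  (fun x => \sum_(n <oo) (if @pickle_inv I n is Some i then F i x else 0)).
  by apply/funext => x; rewrite esum_nneseries.
apply: (@ge0_emeasurable_sum _ _ _ _
  (fun n x => if @pickle_inv I n is Some i then F i x else 0) xpredT).
  by move=> n x _ _; case: (@pickle_inv I n).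
by move=> n _; case: (@pickle_inv I n).
Qed.

Lemma integral_esum (mu : {measure set T -> \bar R}) (D : set T)
    (F : I -> T -> \bar R) : measurable D -> (forall i x, 0 <= F i x) ->
  (forall i, measurable_fun setT (F i)) ->
  \int[mu]_(x in D) (\esum_(i in [set: I]) F i x) =
  \esum_(i in [set: I]) \int[mu]_(x in D) F i x.
Proof.
move=> mD F0 mF.
rewrite esum_nneseries; last by move=> i; apply: integral_ge0.
pose G n x := if @pickle_inv I n is Some i then F i x else 0.
transitivity (\int[mu]_(x in D) (\sum_(n <oo) G n x)).
  by apply: eq_integral => x _; rewrite esum_nneseries.
rewrite integral_nneseries//; first last.
- by move=> n x _; rewrite /G; case: (@pickle_inv I n).
- by move=> n; rewrite /G; case: (@pickle_inv I n) => // i; exact: measurable_funTS.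
apply: eq_eseriesr => n _; rewrite /G; case: (@pickle_inv I n) => //=.
exact: integral0.
Qed.

End esum_countType.

(** A variable with countably many values can be frozen: on each level set of [N] the map is a
    single [F i]. Applied with N^d, Z^d and the renewal index N(k) as index types. *)
Lemma measurable_fun_countable_comp (dT dU : measure_display)
    (T : measurableType dT) (U : measurableType dU) (I : countType)
    (N : T -> I) (F : I -> T -> U) :
  (forall i, measurable (N @^-1` [set i])) ->
  (forall i, measurable_fun setT (F i)) ->
  measurable_fun setT (fun x => F (N x) x).
Proof.
move=> mN mF _ B mB; rewrite setTI.
rewrite (_ : _ @^-1` _ = \bigcup_(i in [set: I]) (N @^-1` [set i] `&` F i @^-1` B)).
  apply: countable_bigcupT_measurable.
    exact: countableP.
  by move=> i; apply: measurableI => //; rewrite -[X in measurable X]setTI; exact: mF.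
apply/seteqP; split => [x /= Bx|x [i _ [/= <-]]//].
by exists (N x).
Qed.

Lemma ge0_integral_null (dT : measure_display) (T : measurableType dT)
    (R : realType) (mu : {measure set T -> \bar R}) (g : T -> \bar R) :
  measurable_fun setT g -> (forall x, 0 <= g x) -> mu setT = 0 ->
  \int[mu]_x g x = 0.
Proof.
move=> mg g0 mu0; rewrite -(@integral_abs_eq0 _ _ _ mu _ _ measurableT mg mu0).
by apply: eq_integral => x _; rewrite gee0_abs.
Qed.

(** * Renewal operators *)

Section Vectors.
Context (d : nat).
Implicit Types (u v w : nvec d).

Lemma nleP u v : reflect (forall j, (u j <= v j)%N) (nle u v).
Proof. exact: forallP. Qed.

Lemma nle_refl u : nle u u.
Proof. exact/nleP. Qed.

Lemma nle_trans v u w : nle u v -> nle v w -> nle u w.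
Proof. by move=> /nleP uv /nleP vw; apply/nleP => j; exact: leq_trans (uv j) (vw j). Qed.

Lemma nvec_addE u v j : (u + v)%R j = (u j + v j)%N.
Proof. by rewrite ffunE. Qed.

Lemma nle_addr u v : nle u (u + v)%R.
Proof. by apply/nleP => j; rewrite nvec_addE leq_addr. Qed.

Lemma nsub_addr u v w : nle v u -> (nsub u v + w)%R = nsub (u + w)%R v.
Proof.
move=> /nleP vu; apply/ffunP => j.
by rewrite nvec_addE [nsub u v j]ffunE [RHS]ffunE nvec_addE addnBAC.
Qed.

(** Removing a nonzero v from u lowers the coordinate sum strictly, so this is induction on that
    sum. *)
Lemma nvec_ind (P : nvec d -> Prop) :
  (forall u, (forall v, v != 0%R -> nle v u -> P (nsub u v)) -> P u) ->
  forall u, P u.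
Proof.
move=> IH u; have [n] := ubnP (\sum_j u j)%N; elim: n u => // n IHn u un.
apply: IH => v v0 /nleP vu; apply: IHn.
have [j vj] : exists j, v j != 0%N.
  apply/existsP; apply: contra_neqT v0 => /existsPn v0.
  by apply/ffunP => j; rewrite ffunE; apply/eqP; have := v0 j; rewrite negbK.
rewrite -ltnS; apply: leq_trans un; rewrite ltnS.
rewrite (bigD1 j)//= [leqRHS](bigD1 j)//= -addSn leq_add//.
  by rewrite ffunE ltn_subrL lt0n vj/= (leq_trans _ (vu j))// lt0n.
by apply: leq_sum => i _; rewrite ffunE leq_subr.
Qed.

End Vectors.

Lemma measurable_nvec (d : nat) (dT : measure_display) (T : measurableType dT)
    (f : T -> nvec d) : measurable_fun setT f -> forall u, measurable (f @^-1` [set u]).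
Proof. by move=> mf u; rewrite -[X in measurable X]setTI; exact: mf. Qed.

Section Operators.
Context (d : nat) (R : realType) (dX : measure_display) (X : measurableType dX).
Context (q : nvec d -> R.-ker X ~> X).
Implicit Types (F G : nvec d -> X -> \bar R) (g f : X * nvec d -> \bar R).

Lemma measurable_fun_prod_nvec (dU : measure_display) (U : measurableType dU)
    (g : X * nvec d -> U) :
  (forall u, measurable_fun setT (fun x => g (x, u))) -> measurable_fun setT g.
Proof.
move=> mg; rewrite (_ : g = fun z => g (z.1, z.2)); last by apply/funext => -[].
apply: (@measurable_fun_countable_comp _ _ (X * nvec d)%type U (nvec d) snd
  (fun u z => g (z.1, u))).
  by apply: measurable_nvec; exact: measurable_snd.
by move=> u; exact: (measurableT_comp (mg u) measurable_fst).
Qed.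

(** The mean of F(jump, new state) over one transition out of [x]. *)
Definition qsum F (x : X) : \bar R := \esum_(v in [set: nvec d]) \int[q v x]_y F v y.

Definition nneg_family F := (forall v y, 0 <= F v y) /\ (forall v, measurable_fun setT (F v)).

Lemma qsum_ge0 F x : (forall v y, 0 <= F v y) -> 0 <= qsum F x.
Proof. by move=> F0; apply: esum_ge0 => v _; exact: integral_ge0. Qed.

Lemma measurable_qsum F : nneg_family F -> measurable_fun setT (qsum F).
Proof.
move=> [F0 mF]; apply: (measurable_fun_esum (F := fun v x => \int[q v x]_y F v y)).
  by move=> v x; exact: integral_ge0.
move=> v; apply: measurable_fun_integral_kernel => //.
by move=> U mU; exact: measurable_kernel.
Qed.

Lemma qsumD F G x : nneg_family F -> nneg_family G ->
  qsum (fun v y => F v y + G v y) x = qsum F x + qsum G x.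
Proof.
move=> [F0 mF] [G0 mG]; rewrite /qsum -esumD; first last.
- by move=> v _; exact: integral_ge0.
- by move=> v _; exact: integral_ge0.
by apply: eq_esum => v _; rewrite ge0_integralD.
Qed.

Lemma qsumZl (c : \bar R) F x : 0 <= c -> nneg_family F ->
  qsum (fun v y => c * F v y) x = c * qsum F x.
Proof.
move=> c0 [F0 mF]; rewrite /qsum -esumZl//; last first.
  by move=> v; exact: integral_ge0.
by apply: eq_esum => v _; rewrite ge0_integralZl.
Qed.

Lemma qsum_series (F : nat -> nvec d -> X -> \bar R) x : (forall n, nneg_family (F n)) ->
  qsum (fun v y => \sum_(n <oo) F n v y) x = \sum_(n <oo) qsum (F n) x.
Proof.
move=> nF; rewrite /qsum -esum_nneseriesC; last first.
  by move=> n v; apply: integral_ge0 => y _; exact: (nF n).1.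
apply: eq_esum => v _; rewrite integral_nneseries//.
  by move=> n; exact: (nF n).2.
by move=> n y _; exact: (nF n).1.
Qed.

Lemma eq_qsum F G x : (forall v y, F v y = G v y) -> qsum F x = qsum G x.
Proof. by move=> FG; congr (qsum _ x); apply/funext => v; apply/funext => y. Qed.

(** Strictness makes the summand v = 0 an integral against a null measure, so the two families need
    not agree there. *)
Lemma eq_qsum_strict F G x : strict_kernel q -> nneg_family F -> nneg_family G ->
  (forall v y, v != 0%R -> F v y = G v y) -> qsum F x = qsum G x.
Proof.
move=> q0 [F0 mF] [G0 mG] FG; apply: eq_esum => v _.
have [->|v0] := eqVneq v 0%R.
  by rewrite !ge0_integral_null// q0.
by apply: eq_integral => y _; rewrite FG.
Qed.

Lemma Hbar_qsum u x : Hbar q u x = qsum (fun v _ => (~~ nle v u)%:R%:E) x.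
Proof.
rewrite /Hbar /qsum esum_mkcond; apply: eq_esum => v _.
rewrite integral_cst//; case: ifPn; first by rewrite inE /= => ->; rewrite mul1e.
by rewrite notin_setE /= => /negP; rewrite negbK => ->; rewrite mul0e.
Qed.

Lemma nneg_family_indic (p : pred (nvec d)) : nneg_family (fun v _ => (p v)%:R%:E).
Proof. by split => // v y; rewrite lee_fin. Qed.

Lemma Hbar_ge0 u x : 0 <= Hbar q u x.
Proof. by rewrite Hbar_qsum; apply: qsum_ge0; exact: (nneg_family_indic _).1. Qed.

Lemma measurable_Hbar u : measurable_fun setT (Hbar q u).
Proof.
rewrite (_ : Hbar q u = qsum (fun v _ => (~~ nle v u)%:R%:E)).
  by apply: measurable_qsum; exact: nneg_family_indic.
by apply/funext => x; exact: Hbar_qsum.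
Qed.

Lemma measurable_Hbar_prod :
  measurable_fun setT (fun z : X * nvec d => Hbar q z.2 z.1).
Proof. by apply: measurable_fun_prod_nvec => u; exact: measurable_Hbar. Qed.

Lemma le_Hbar u v x : ~~ nle v u -> q v x setT <= Hbar q u x.
Proof.
move=> vu; apply: esum_ge; exists [set v]; last by rewrite fsbig_set1.
by split; [exact: finite_set1|move=> w /= ->].
Qed.

(** Each q_v with v not below u has mass at most [Hbar] at u, hence is null, and F vanishes for the
    remaining v. *)
Lemma qsum_Hbar_eq0 u x F : Hbar q u x = 0 -> nneg_family F ->
  (forall v y, nle v u -> F v y = 0) -> qsum F x = 0.
Proof.
move=> H0 [F0 mF] Fu; apply: esum1 => v _.
have [vu|vu] := boolP (nle v u); first by rewrite integral0_eq// => y _; exact: Fu.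
apply: ge0_integral_null => //; apply/eqP; rewrite eq_le measure_ge0 andbT -H0.
exact: le_Hbar.
Qed.

Lemma total_mass_qsum x : total_mass_one q -> qsum (fun _ _ => 1) x = 1.
Proof.
move=> q1; rewrite -[RHS](q1 x); apply: eq_esum => v _.
by rewrite integral_cst// mul1e.
Qed.

Lemma Hbar_fin u x : total_mass_one q -> Hbar q u x \is a fin_num.
Proof.
move=> q1; rewrite ge0_fin_numE ?Hbar_ge0//; apply: (@le_lt_trans _ _ 1); last exact: ltry.
rewrite -(total_mass_qsum x q1) Hbar_qsum; apply: le_esum => v _.
by apply: ge0_le_integral => //= y _; rewrite lee_fin; case: (nle v u).
Qed.

(* In a pair (x, u) with u read as remaining time, [qstep g (x, u)] is the mean of
   g after one jump, on the event that the jump fits into u. *)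
Definition qstep g (z : X * nvec d) : \bar R :=
  qsum (fun v y => if nle v z.2 then g (y, nsub z.2 v) else 0) z.1.

Definition nneg_measurable g := (forall z, 0 <= g z) /\ measurable_fun setT g.

Lemma measurable_slice g u : nneg_measurable g -> measurable_fun setT (fun y => g (y, u)).
Proof. by move=> [_ mg]; exact: (measurableT_comp mg (pair2_measurable u)). Qed.

Lemma nneg_family_slice g (b : pred (nvec d)) (s : nvec d -> nvec d) : nneg_measurable g ->
  nneg_family (fun v y => if b v then g (y, s v) else 0).
Proof.
move=> ng; split => [v y|v]; first by case: (b v) => //; exact: ng.1.
by case: (b v) => //; exact: measurable_slice.
Qed.

Lemma nneg_family_step g u : nneg_measurable g ->
  nneg_family (fun v y => if nle v u then g (y, nsub u v) else 0).
Proof. exact: (nneg_family_slice (fun v => nle v u) (nsub u)). Qed.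

Lemma nneg_family_leap g u h : nneg_measurable g ->
  nneg_family (fun v y => if nle v (u + h)%R && ~~ nle v u then g (y, nsub (u + h)%R v) else 0).
Proof. exact: (nneg_family_slice (fun v => nle v (u + h)%R && ~~ nle v u) (nsub (u + h)%R)). Qed.

Lemma nneg_measurable_prod g : (forall z, 0 <= g z) ->
  (forall u, measurable_fun setT (fun x => g (x, u))) -> nneg_measurable g.
Proof. by move=> g0 mg; split => //; exact: measurable_fun_prod_nvec. Qed.

Lemma nneg_measurable_qstep g : nneg_measurable g -> nneg_measurable (qstep g).
Proof.
move=> ng; apply: nneg_measurable_prod => [z|u].
  exact: (qsum_ge0 _ (nneg_family_step z.2 ng).1).
exact: (measurable_qsum (nneg_family_step u ng)).
Qed.

Lemma nneg_measurable_iter g n : nneg_measurable g -> nneg_measurable (iter n qstep g).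
Proof. by move=> ng; elim: n => //= n; exact: nneg_measurable_qstep. Qed.

Lemma nneg_measurable_Hbar g : nneg_measurable g -> nneg_measurable (fun z => Hbar q z.2 z.1 * g z).
Proof.
move=> [g0 mg]; split => [z|]; first by rewrite mule_ge0// Hbar_ge0.
by apply: emeasurable_funM => //; exact: measurable_Hbar_prod.
Qed.

(* The n-th term is the contribution of n renewals up to time z.2, so this is
   the function K_t g of the paper at z = (y, t). *)
Definition green g (z : X * nvec d) : \bar R :=
  \sum_(n <oo) iter n qstep (fun z => Hbar q z.2 z.1 * g z) z.

Lemma nneg_measurable_green g : nneg_measurable g -> nneg_measurable (green g).
Proof.
move=> ng; split => [z|].
  by apply: nneseries_ge0 => n _ _; apply: (nneg_measurable_iter _ (nneg_measurable_Hbar ng)).1.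
apply: (@ge0_emeasurable_sum _ _ _ _
  (fun n => iter n qstep (fun z => Hbar q z.2 z.1 * g z)) xpredT).
  by move=> n z _ _; apply: (nneg_measurable_iter _ (nneg_measurable_Hbar ng)).1.
by move=> n _; exact: (nneg_measurable_iter _ (nneg_measurable_Hbar ng)).2.
Qed.

(** First-jump decomposition: every term after n = 0 has an outermost [qstep], which monotone
    convergence moves out of the series. *)
Lemma greenE g z : nneg_measurable g -> green g z = Hbar q z.2 z.1 * g z + qstep (green g) z.
Proof.
move=> ng; have ni n := nneg_measurable_iter n (nneg_measurable_Hbar ng).
rewrite {1}/green (@nneseries_split _ _ 0 1); last by move=> k _; exact: (ni k).1.
rewrite big_nat1/=; congr (_ + _).
rewrite -nneseries_addn; last by move=> k; exact: (ni _).1.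
rewrite {2}/qstep /green.
rewrite [RHS](_ : _ = qsum (fun v y => \sum_(n <oo) (if nle v z.2 then
   iter n qstep (fun z => Hbar q z.2 z.1 * g z) (y, nsub z.2 v) else 0)) z.1); last first.
  by apply: eq_qsum => v y; case: (nle v z.2) => //; rewrite eseries0.
rewrite qsum_series; last by move=> n; exact: nneg_family_step.
by apply: eq_eseriesr => n _; rewrite add0n addn1 iterS.
Qed.

(* The numerator of R_h: [Hbar u x * R_h g (x, u)]. *)
Definition jump h g (z : X * nvec d) : \bar R :=
  Hbar q (z.2 + h)%R z.1 * g (z.1, (z.2 + h)%R) +
  qsum (fun v y => if nle v (z.2 + h)%R && ~~ nle v z.2
                   then green g (y, nsub (z.2 + h)%R v) else 0) z.1.

Lemma nneg_measurable_jump h g : nneg_measurable g -> nneg_measurable (jump h g).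
Proof.
move=> ng; apply: nneg_measurable_prod => [z|u].
  rewrite adde_ge0 ?mule_ge0 ?Hbar_ge0 ?ng.1//.
  exact: (qsum_ge0 _ (nneg_family_leap z.2 h (nneg_measurable_green ng)).1).
apply: emeasurable_funD; first apply: emeasurable_funM.
- exact: (measurable_Hbar (u + h)%R).
- exact: (measurable_slice (u + h)%R ng).
exact: (measurable_qsum (nneg_family_leap u h (nneg_measurable_green ng))).
Qed.

(* K_t R_r = K_{t+r}: strictness makes the renewal equation [greenE] an induction
   on t. *)
Lemma green_shift r g f : strict_kernel q -> nneg_measurable g -> nneg_measurable f ->
  (forall z, Hbar q z.2 z.1 * f z = jump r g z) ->
  forall t y, green f (y, t) = green g (y, (t + r)%R).
Proof.
move=> q0 ng nf fg; elim/nvec_ind => t IH y.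
rewrite (greenE (y, t) nf) (greenE (y, (t + r)%R) ng) (fg (y, t)).
rewrite -[jump r g (y, t)]/(Hbar q (t + r)%R y * g (y, (t + r)%R) + qsum _ y).
rewrite -addeA; congr (_ + _).
rewrite -[qstep (green f) (y, t)]/(qsum _ y).
rewrite -[qstep (green g) (y, (t + r)%R)]/(qsum _ y).
rewrite -qsumD; first last.
- exact: (nneg_family_step t (nneg_measurable_green nf)).
- exact: (nneg_family_leap t r (nneg_measurable_green ng)).
(* This discards v = 0, for which t - v is t itself and the induction hypothesis would be
   circular. *)
apply: eq_qsum_strict => //.
- split => [v z|v].
    apply: adde_ge0.
      exact: (nneg_family_leap t r (nneg_measurable_green ng)).1.
    exact: (nneg_family_step t (nneg_measurable_green nf)).1.
  apply: emeasurable_funD.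
    exact: (nneg_family_leap t r (nneg_measurable_green ng)).2.
  exact: (nneg_family_step t (nneg_measurable_green nf)).2.
- exact: (nneg_family_step (t + r)%R (nneg_measurable_green ng)).
(* A jump v <= t appears only in the [qstep] sum, where the induction hypothesis applies at t - v.
   Any other jump appears only in the sum coming from [jump], and there both sides already agree. *)
move=> v z v0; have [vt|vt] := boolP (nle v t).
  rewrite (nle_trans vt (nle_addr _ _)) add0e IH// nsub_addr//.
by rewrite andbT adde0.
Qed.

End Operators.

Lemma measurable_fun_inve (dT : measure_display) (T : measurableType dT)
    (R : realType) (H : T -> \bar R) :
  measurable_fun setT H -> (forall x, 0 <= H x) ->
  measurable_fun setT (fun x => (H x)^-1).
Proof.
move=> mH H0; apply: (measurability _ (ErealGenCInfty.measurableE R)) => //.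
move=> _ [_ [r ->] <-]; rewrite setTI.
rewrite (_ : _ @^-1` _ = [set x | r%:E <= (H x)^-1]); last first.
  by apply/seteqP; split => x /=; rewrite in_itv /= andbT.
have [r0|r0] := ltP r 0%R.
  rewrite (_ : [set x | _] = setT) //; apply/seteqP; split => x //= _.
  by apply: (@le_trans _ _ 0); [rewrite lee_fin ltW|rewrite inve_ge0].
(* The case r = 0 is covered because the inverse of 0 is +oo. *)
rewrite (_ : [set x | _] = [set x | H x <= (r%:E)^-1]); last first.
  by apply/seteqP; split => x /=; rewrite inve_pge// inE// lee_fin.
by rewrite -[X in measurable X]setTI; exact: emeasurable_fun_infty_c.
Qed.

(** * The transition operators and their semigroup property *)

Section Transition.
Context (d : nat) (R : realType) (dX : measure_display) (X : measurableType dX).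
Context (q : nvec d -> R.-ker X ~> X).
Implicit Types (g f : X * nvec d -> \bar R).

Lemma nnle_add (u v w : nvec d) : ~~ nle v (u + w)%R -> ~~ nle v u.
Proof. by apply: contra => vu; exact: nle_trans vu (nle_addr _ _). Qed.

(** [f] stands for R_r g but is pinned down only after multiplication by [Hbar], so that R_r g
    restricted to the admissible set qualifies too. *)
Lemma jump_add h r g f : strict_kernel q -> nneg_measurable g -> nneg_measurable f ->
  (forall z, Hbar q z.2 z.1 * f z = jump q r g z) ->
  forall z, jump q h f z = jump q (h + r)%R g z.
Proof.
move=> q0 ng nf fg [x u]; rewrite {1}/jump /= (fg (x, (u + h)%R)) /jump/=.
rewrite !addrA -!addeA; congr (_ + _).
rewrite -qsumD; first last.
- exact: (nneg_family_leap u h (nneg_measurable_green q nf)).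
- exact: (nneg_family_leap (u + h)%R r (nneg_measurable_green q ng)).
apply: eq_qsum => v y.
have [vuh|vuh] := boolP (nle v (u + h)%R).
  rewrite andbF add0e (nle_trans vuh (nle_addr _ _)) /=.
  case: ifPn => // _; rewrite (green_shift q0 ng nf fg) nsub_addr//.
by rewrite (nnle_add vuh) adde0.
Qed.

(** R_h as an operator on nonnegative functions. It is defined at all pairs, but is identified with
    [Rker] at admissible ones only. *)
Definition trans h g (z : X * nvec d) : \bar R := (Hbar q z.2 z.1)^-1 * jump q h g z.

Lemma nneg_measurable_trans h g : nneg_measurable g -> nneg_measurable (trans h g).
Proof.
move=> ng; have nj := nneg_measurable_jump q h ng.
split => [z|]; first by rewrite mule_ge0 ?inve_ge0 ?Hbar_ge0 ?nj.1.
apply: emeasurable_funM; last exact: nj.2.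
by apply: measurable_fun_inve; [exact: measurable_Hbar_prod|move=> z; exact: Hbar_ge0].
Qed.

Lemma le_HbarD u h x : Hbar q (u + h)%R x <= Hbar q u x.
Proof.
rewrite !Hbar_qsum; apply: le_esum => v _.
apply: ge0_le_integral => //= y _; rewrite lee_fin ler_nat.
by have [//|] := boolP (nle v (u + h)%R) => /nnle_add ->.
Qed.

(** No mass beyond u means none beyond u + h, and the sum in [jump] only sees jumps not below u. *)
Lemma jump_eq0 h g z : nneg_measurable g -> Hbar q z.2 z.1 = 0 -> jump q h g z = 0.
Proof.
move=> ng H0; rewrite /jump.
have -> : Hbar q (z.2 + h)%R z.1 = 0.
  by apply/eqP; rewrite eq_le Hbar_ge0 andbT -H0; exact: le_HbarD.
rewrite mul0e add0e (qsum_Hbar_eq0 H0)//.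
  exact: (nneg_family_leap z.2 h (nneg_measurable_green q ng)).
by move=> v y ->; rewrite andbF.
Qed.

(* Off the admissible set the inverse of [Hbar] is [+oo], but then [jump] is 0. *)
Lemma Hbar_trans h g z : total_mass_one q -> nneg_measurable g ->
  Hbar q z.2 z.1 * trans h g z = jump q h g z.
Proof.
move=> q1 ng; have [H0|H0] := eqVneq (Hbar q z.2 z.1) 0.
  by rewrite jump_eq0// H0 mul0e.
by rewrite /trans muleA divee ?mul1e// Hbar_fin.
Qed.

Lemma nneg_measurable_restrict g (E : set (X * nvec d)) : measurable E ->
  nneg_measurable g -> nneg_measurable (g \_ E).
Proof.
move=> mE [g0 mg]; split; first by move=> z; exact: erestrict_ge0.
by apply/(measurable_restrictT _ _).1 => //; exact: measurable_funTS.
Qed.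

Lemma measurable_admissible : measurable (admissible q).
Proof.
rewrite -[X in measurable X]setTI.
by apply: emeasurable_fun_o_infty => //; exact: measurable_Hbar_prod.
Qed.

Lemma Hbar_restrict g z : Hbar q z.2 z.1 * (g \_ (admissible q)) z = Hbar q z.2 z.1 * g z.
Proof.
rewrite patchE; case: ifPn => //; rewrite notin_setE /admissible /= => /negP.
rewrite -leNgt => H0; suff -> : Hbar q z.2 z.1 = 0 by rewrite !mul0e.
by apply/eqP; rewrite eq_le H0 Hbar_ge0.
Qed.

(** The restriction on the left is there because the composition of kernels integrates over the
    admissible set only; multiplication by [Hbar] makes it invisible. *)
Lemma trans_add h r g z : strict_kernel q -> total_mass_one q -> nneg_measurable g ->
  trans h (trans r g \_ (admissible q)) z = trans (h + r)%R g z.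
Proof.
move=> q0 q1 ng; have mE := measurable_admissible.
have nf := nneg_measurable_restrict mE (nneg_measurable_trans r ng).
have fg w : Hbar q w.2 w.1 * (trans r g \_ (admissible q)) w = jump q r g w.
  by rewrite (Hbar_restrict (trans r g) w) (Hbar_trans r w q1 ng).
by rewrite -[LHS]/(_ * _) (jump_add h q0 ng nf fg).
Qed.

Lemma green_restrict g : green q (g \_ (admissible q)) = green q g.
Proof.
rewrite /green.
have -> : (fun z => Hbar q z.2 z.1 * (g \_ (admissible q)) z) =
          (fun z => Hbar q z.2 z.1 * g z) by apply/funext => z; exact: Hbar_restrict.
by [].
Qed.

Lemma trans_restrict h g : trans h (g \_ (admissible q)) = trans h g.
Proof.
apply/funext => z; rewrite /trans /jump green_restrict.
by rewrite (Hbar_restrict g (z.1, (z.2 + h)%R)).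
Qed.

(** With K 1 = 1, the numerator is the mass of the jumps leaving u + h plus that of the jumps
    leaving u but not u + h, which is [Hbar] at u. *)
Lemma trans1 h z : total_mass_one q -> admissible q z ->
  (forall z', green q (fun _ => 1) z' = 1) -> trans h (fun _ => 1) z = 1.
Proof.
move=> q1 Ez G1; have H0 : Hbar q z.2 z.1 != 0 by rewrite gt_eqF.
rewrite /trans -[RHS](mulVe H0 (Hbar_fin _ _ q1)); congr (_ * _).
rewrite /jump mule1 !Hbar_qsum -qsumD; first last.
- by apply: nneg_family_leap; apply: nneg_measurable_green; split.
- by split => // v y; rewrite lee_fin.
apply: eq_qsum => v y; rewrite G1.
have [vu|vu] := boolP (nle v (z.2 + h)%R); last by rewrite (nnle_add vu) adde0.
by rewrite add0e; case: (nle v z.2).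
Qed.

End Transition.

Lemma nneseries_mull (R : realType) (k : \bar R) (a : nat -> \bar R) :
  0 <= k -> (forall n, 0 <= a n) ->
  \sum_(n <oo) (k * a n) = k * \sum_(n <oo) a n.
Proof.
move=> k0 a0; rewrite !nneseries_esumT ?esumZl// => n; exact: mule_ge0.
Qed.

Lemma esum_single (R : realType) (I : choiceType) (a : I -> \bar R) i :
  0 <= a i -> (forall j, j != i -> a j = 0) -> \esum_(j in [set: I]) a j = a i.
Proof.
move=> ai a0; rewrite -[RHS](esum_set1 ai) [RHS]esum_mkcond; apply: eq_esum => j _.
have [->|ji] := eqVneq j i; first by rewrite ifT// inE.
by rewrite a0//; case: ifP.
Qed.

(** * One step of the chain *)

Section SigmaGenerated.
Context (dO : measure_display) (Omega : measurableType dO).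
Context (I : Type) (D : set I) (dT : measure_display) (T : measurableType dT).
Context (Y : I -> Omega -> T).

Let G := \bigcup_(i in D) preimage_set_system setT (Y i) measurable.

Lemma sigma_generated_measurable : (forall i, D i -> measurable_fun setT (Y i)) ->
  sigma_generated D Y `<=` measurable.
Proof.
move=> mY; apply: smallest_sub; first exact: sigma_algebra_measurable.
by move=> _ [i Di [B mB <-]]; exact: mY.
Qed.

Lemma sigma_generated_preimage i B : D i -> measurable B ->
  sigma_generated D Y (Y i @^-1` B).
Proof.
by move=> Di mB; apply: sub_sigma_algebra; exists i => //; exists B; rewrite // setTI.
Qed.

Lemma sigma_generatedT : sigma_generated D Y setT.
Proof. exact: (@measurableT _ (g_sigma_algebraType G)). Qed.

Lemma sigma_generatedI A B : sigma_generated D Y A -> sigma_generated D Y B ->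
  sigma_generated D Y (A `&` B).
Proof. exact: (@measurableI _ (g_sigma_algebraType G)). Qed.

Lemma sigma_generatedC A : sigma_generated D Y A -> sigma_generated D Y (~` A).
Proof. exact: (@measurableC _ (g_sigma_algebraType G)). Qed.

Lemma sigma_generated_bigcup (A : (set Omega)^nat) :
  (forall n, sigma_generated D Y (A n)) -> sigma_generated D Y (\bigcup_n A n).
Proof. by move=> mA; apply: (@bigcup_measurable _ (g_sigma_algebraType G)) => n _; exact: mA. Qed.

End SigmaGenerated.

Lemma sigma_generatedS (dO : measure_display) (Omega : measurableType dO)
    (I : Type) (D D' : set I) (dT : measure_display) (T : measurableType dT)
    (Y : I -> Omega -> T) : D `<=` D' ->
  sigma_generated D Y `<=` sigma_generated D' Y.
Proof.
move=> DD'; apply: sub_sigma_algebra2; exact: bigcup_subset.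
Qed.

Section OneStep.
Context (d : nat) (R : realType) (dX : measure_display) (X : measurableType dX).
Context (q : nvec d -> R.-ker X ~> X).
Context (dO : measure_display) (Omega : measurableType dO) (P : probability Omega R).
Context (J : nat -> Omega -> X) (S : nat -> Omega -> zvec d).
Hypothesis mJS : measurable_path J S.

Lemma measurable_JS n : measurable_fun setT (fun w => (J n w, S n w)).
Proof. by apply: measurable_fun_pair; [exact: (mJS n).1|exact: (mJS n).2]. Qed.

Lemma history_measurable n : history J S n `<=` measurable.
Proof. by apply: sigma_generated_measurable => i _; exact: measurable_JS. Qed.

Lemma historyP n m (C : set (X * zvec d)) : (m <= n)%N -> measurable C ->
  history J S n [set w | C (J m w, S m w)].
Proof. by move=> mn mC; exact: (@sigma_generated_preimage _ Omega _ [set m | (m <= n)%N] _ _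
  (fun m w => (J m w, S m w)) m C mn mC). Qed.

Lemma history_le m n : (m <= n)%N -> history J S m `<=` history J S n.
Proof. by move=> mn; apply: sigma_generatedS => i /= im; exact: leq_trans im mn. Qed.

Lemma measurable_zset (f : zvec d -> bool) (n : nat) : measurable [set w | f (S n w)].
Proof. by rewrite -[X in measurable X]setTI; exact: ((mJS n).2 measurableT [set s | f s]). Qed.

Lemma history_zset (f : zvec d -> bool) n m : (m <= n)%N -> history J S n [set w | f (S m w)].
Proof.
move=> mn; apply: (historyP (C := [set z | f z.2])) => //.
rewrite -[X in measurable X]setTI.
exact: (@measurable_snd _ _ X (zvec d) measurableT [set s | f s]).
Qed.

(** When the factor is an indicator of (J_n, S_n), inserting it means intersecting H with another
    set of the history. This is why H stays universally quantified during the induction on the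
    factor. *)
Lemma integral_history_mul n (V W : Omega -> \bar R) :
  measurable_fun setT V -> measurable_fun setT W ->
  (forall w, 0 <= V w) -> (forall w, 0 <= W w) ->
  (forall H, history J S n H -> \int[P]_(w in H) V w = \int[P]_(w in H) W w) ->
  forall (f : X * zvec d -> \bar R), measurable_fun setT f -> (forall z, 0 <= f z) ->
  forall H, history J S n H ->
    \int[P]_(w in H) (f (J n w, S n w) * V w) = \int[P]_(w in H) (f (J n w, S n w) * W w).
Proof.
move=> mV mW V0 W0 VW.
have mf (f : X * zvec d -> \bar R) :
    measurable_fun setT f -> measurable_fun setT (fun w => f (J n w, S n w)).
  by move=> mf; exact: (measurableT_comp mf (measurable_JS n)).
apply: (@ge0_measurable_ind _ (X * zvec d)%type) => [C a mC a0 H hH|g mg g0 IH H hH].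
  have mH := history_measurable hH.
  have E (U : Omega -> \bar R) : measurable_fun setT U -> (forall w, 0 <= U w) ->
    \int[P]_(w in H) (a%:E * (\1_C (J n w, S n w))%:E * U w) =
    a%:E * \int[P]_(w in H `&` [set w | C (J n w, S n w)]) U w.
    move=> mU U0.
    rewrite integral_mkcondr -ge0_integralZl//; first last.
    - by move=> w _; apply: erestrict_ge0.
    - apply: measurable_funTS; apply/(measurable_restrictT _ _).1.
        by rewrite -[X in measurable X]setTI; exact: measurable_JS.
      exact: measurable_funTS.
    apply: eq_integral => w _; rewrite patchE indicE -muleA.
    have -> : ((J n w, S n w) \in C) = (w \in [set w | C (J n w, S n w)]).
      by apply/idP/idP; rewrite !inE.
    by case: ifP => _; rewrite ?mul1e ?mul0e.
  rewrite !E// VW//; apply: sigma_generatedI => //; exact: historyP.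
have mH := history_measurable hH.
have E (U : Omega -> \bar R) : measurable_fun setT U -> (forall w, 0 <= U w) ->
    \int[P]_(w in H) ((\sum_(i <oo) g i (J n w, S n w)) * U w) =
    \sum_(i <oo) \int[P]_(w in H) (g i (J n w, S n w) * U w).
  move=> mU U0; rewrite -integral_nneseries//; first last.
  - by move=> i w _; rewrite mule_ge0.
  - by move=> i; apply: measurable_funTS; apply: emeasurable_funM => //; exact: mf.
  apply: eq_integral => w _; rewrite muleC -nneseries_mull//.
  by apply: eq_eseriesr => i _; rewrite muleC.
by rewrite !E//; apply: eq_eseriesr => i _; exact: IH.
Qed.

(** The step kernel is c times q_v: c = 1 gives an ordinary step, and the residual step is obtained
    with c = 1 / [Hbar] outside the jumps v <= u and c = 0 on them. *)
Variable c : X * zvec d -> nvec d -> \bar R.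
Hypothesis c0 : forall z v, 0 <= c z v.
Hypothesis mc : forall v, measurable_fun setT (c ^~ v).

Local Notation D n v w := ((S n.+1 w - S n w)%R == zvec_of v).

Lemma measurable_increment n v : measurable [set w | (S n.+1 w - S n w)%R = zvec_of v].
Proof.
rewrite (_ : [set w | _] = \bigcup_(s in [set: zvec d])
  ([set w | S n.+1 w = (s + zvec_of v)%R] `&` [set w | S n w = s])).
  apply: countable_bigcupT_measurable; first exact: countableP.
  by move=> s; apply: measurableI; rewrite -[X in measurable X]setTI;
    [exact: ((mJS n.+1).2 measurableT [set (s + zvec_of v)%R])
    |exact: ((mJS n).2 measurableT [set s])].
apply/seteqP; split => [w /= E|w [s _ [/= -> ->]]].
  by exists (S n w) => //=; rewrite -E addrC subrK.
by rewrite addrC addrA addNr add0r.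
Qed.

(** [transition_at] speaks of indicators of the next state only. The function g is built from those
    indicators, and f is inserted afterwards as a factor known from the history. *)
Lemma one_step n : transition_at J S P n (fun z v A => c z v * q v z.1 A) ->
  forall (f : X * zvec d -> \bar R), measurable_fun setT f -> (forall z, 0 <= f z) ->
  forall v (g : X -> \bar R), measurable_fun setT g -> (forall y, 0 <= g y) ->
  forall H, history J S n H ->
  \int[P]_(w in H) (f (J n w, S n w) * ((D n v w)%:R%:E * g (J n.+1 w))) =
  \int[P]_(w in H) (f (J n w, S n w) * (c (J n w, S n w) v * \int[q v (J n w)]_y g y)).
Proof.
move=> tn f mf f0 v.
have mD : measurable_fun setT (fun w => (D n v w)%:R%:E : \bar R).
  apply/measurable_EFinP; rewrite (_ : (fun w => _) =
    \1_[set w | (S n.+1 w - S n w)%R = zvec_of v]).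
    exact/measurable_indic/measurable_increment.
  apply/funext => w; rewrite indicE; congr (nat_of_bool _)%:R.
  by apply/eqP/idP => [Dw|/set_mem//]; exact/mem_set.
have mcJ : measurable_fun setT (fun w => c (J n w, S n w) v).
  exact: (measurableT_comp (mc v) (measurable_JS n)).
have mfJ : measurable_fun setT (fun w => f (J n w, S n w)).
  exact: (measurableT_comp mf (measurable_JS n)).
have mq (g : X -> \bar R) : measurable_fun setT g -> (forall y, 0 <= g y) ->
    measurable_fun setT (fun w => \int[q v (J n w)]_y g y).
  move=> mg g0; have mi : measurable_fun setT (fun x => \int[q v x]_y g y).
    by apply: measurable_fun_integral_kernel => // U mU; exact: measurable_kernel.
  exact: (measurableT_comp mi (mJS n).1).
apply: (@ge0_measurable_ind _ X) => [A a mA a0 H hH|g mg g0 IH H hH].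
  have [_ _ _ _ E] := tn v A mA.
  have mA1 : measurable_fun setT (fun y => (\1_A y)%:E : \bar R).
    exact/measurable_EFinP/measurable_indic.
  have D0 w : 0 <= (D n v w)%:R%:E :> \bar R by rewrite lee_fin.
  apply: integral_history_mul => //.
  - apply: emeasurable_funM => //; apply: measurable_funeM.
    exact: (measurableT_comp mA1 (mJS n.+1).1).
  - apply: emeasurable_funM => //; apply: mq => //.
      by apply: measurable_funeM; exact/measurable_EFinP/measurable_indic.
    by move=> y; rewrite mule_ge0.
  - by move=> w; rewrite !mule_ge0.
  - by move=> w; rewrite mule_ge0// integral_ge0// => y _; rewrite mule_ge0.
  move=> H' hH'; have mH' := history_measurable hH'.
  transitivity (a%:E * \int[P]_(w in H') (\1_(jump_event J S n v A) w)%:E).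
    rewrite -ge0_integralZl//; first last.
    - apply: measurable_funTS; apply/measurable_EFinP/measurable_indic.
      apply: measurableI; last exact: measurable_increment.
      by rewrite -[X in measurable X]setTI; exact: (mJS n.+1).1.
    apply: eq_integral => w _; rewrite muleCA; congr (_ * _).
    rewrite -EFinM !indicE -natrM mulnb; congr ((nat_of_bool _)%:R%:E).
    apply/andP/idP => [[/eqP Dw /set_mem Aw]|/set_mem[Aw Dw]].
      exact/mem_set.
    by split; [exact/eqP|exact/mem_set].
  rewrite -E// -ge0_integralZl//; first last.
  - by move=> w _; rewrite mule_ge0.
  - apply: measurable_funTS; apply: emeasurable_funM => //.
    exact: (measurableT_comp (measurable_kernel (q v) _ mA) (mJS n).1).
  apply: eq_integral => w _; rewrite muleCA; congr (_ * _).
  rewrite ge0_integralZl//.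
  by rewrite integral_indic// setIT.
have mH := history_measurable hH.
transitivity (\sum_(i <oo) \int[P]_(w in H)
    (f (J n w, S n w) * ((D n v w)%:R%:E * g i (J n.+1 w)))).
  rewrite -integral_nneseries//; first last.
  - by move=> i w _; rewrite !mule_ge0.
  - move=> i; apply: measurable_funTS; apply: emeasurable_funM => //.
    by apply: emeasurable_funM => //; exact: (measurableT_comp (mg i) (mJS n.+1).1).
  apply: eq_integral => w _; rewrite -nneseries_mull//.
  by rewrite -nneseries_mull// => i; rewrite mule_ge0.
under eq_eseriesr do rewrite IH//.
rewrite -integral_nneseries//; first last.
- by move=> i w _; rewrite !mule_ge0// integral_ge0.
- move=> i; apply: measurable_funTS; apply: emeasurable_funM => //.
  by apply: emeasurable_funM => //; exact: mq.
apply: eq_integral => w _; rewrite integral_nneseries//.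
rewrite -nneseries_mull//; last by move=> i; exact: integral_ge0.
by rewrite -nneseries_mull// => i; rewrite mule_ge0// integral_ge0.
Qed.

End OneStep.

Lemma zvec_ofK (d : nat) : cancel (@zvec_of d) (@nvec_of d).
Proof. by move=> v; apply/ffunP => j; rewrite !ffunE. Qed.

Lemma zleP (d : nat) (s t : zvec d) : reflect (forall j, s j <= t j)%R (zle s t).
Proof. exact: forallP. Qed.

Lemma zle0P (d : nat) (s : zvec d) : reflect (exists v, s = zvec_of v) (zle 0%R s).
Proof.
apply: (iffP (zleP _ _)) => [s0|[v ->] j]; last by rewrite !ffunE.
exists (nvec_of s); apply/ffunP => j; rewrite !ffunE.
by have := s0 j; rewrite ffunE => /gez0_abs.
Qed.

Section OneStepSum.
Context (d : nat) (R : realType) (dX : measure_display) (X : measurableType dX).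
Context (q : nvec d -> R.-ker X ~> X).
Context (dO : measure_display) (Omega : measurableType dO) (P : probability Omega R).
Context (J : nat -> Omega -> X) (S : nat -> Omega -> zvec d).
Hypothesis mJS : measurable_path J S.
Variable c : X * zvec d -> nvec d -> \bar R.
Hypothesis c0 : forall z v, 0 <= c z v.
Hypothesis mc : forall v, measurable_fun setT (c ^~ v).

Lemma measurable_fun_prod_zvec (dU : measure_display) (U : measurableType dU)
    (g : X * zvec d -> U) :
  (forall s, measurable_fun setT (fun x => g (x, s))) -> measurable_fun setT g.
Proof.
move=> mg; rewrite (_ : g = fun z => g (z.1, z.2)); last by apply/funext => -[].
apply: (@measurable_fun_countable_comp _ _ (X * zvec d)%type U (zvec d) snd
  (fun s z => g (z.1, s))).
  move=> s; rewrite -[X in measurable X]setTI.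
  exact: (@measurable_snd _ _ X (zvec d) measurableT [set s]).
by move=> u; exact: (measurableT_comp (mg u) measurable_fst).
Qed.

Lemma measurable_fun_zvec_pred (b : zvec d -> bool) :
  measurable_fun setT (fun z : X * zvec d => (b z.2)%:R%:E : \bar R).
Proof. by apply: measurable_fun_prod_zvec => s /=; exact: measurable_cst. Qed.

Lemma measurable_int_kernel (v : nvec d) n (g : X -> \bar R) :
  measurable_fun setT g -> (forall y, 0 <= g y) ->
  measurable_fun setT (fun w => \int[q v (J n w)]_y g y).
Proof.
move=> mg g0; have mi : measurable_fun setT (fun x => \int[q v x]_y g y).
  by apply: measurable_fun_integral_kernel => // U mU; exact: measurable_kernel.
exact: (measurableT_comp mi (mJS n).1).
Qed.

Lemma measurable_increment_indic n v : measurable_fun setT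
  (fun w => ((S n.+1 w - S n w)%R == zvec_of v)%:R%:E : \bar R).
Proof.
apply/measurable_EFinP; rewrite (_ : (fun w => _) =
    \1_[set w | (S n.+1 w - S n w)%R = zvec_of v]).
  by apply: measurable_indic; exact: (measurable_increment mJS).
apply/funext => w; rewrite indicE; congr (nat_of_bool _)%:R.
by apply/eqP/idP => [Dw|/set_mem//]; exact/mem_set.
Qed.

(** The increment is a priori a vector of Z^d; the value 0 is a default for increments outside
    N^d. *)
Definition after (g : zvec d -> nvec d -> X -> \bar R) n w : \bar R :=
  if zle 0%R (S n.+1 w - S n w)%R
  then g (S n w) (nvec_of (S n.+1 w - S n w)%R) (J n.+1 w) else 0.

Lemma one_step_sum n (f : X * zvec d -> \bar R) (g : zvec d -> nvec d -> X -> \bar R) H :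
  transition_at J S P n (fun z v A => c z v * q v z.1 A) ->
  measurable_fun setT f -> (forall z, 0 <= f z) ->
  (forall s v, measurable_fun setT (g s v)) -> (forall s v y, 0 <= g s v y) ->
  history J S n H ->
  \int[P]_(w in H) (f (J n w, S n w) * after g n w) =
  \int[P]_(w in H) (f (J n w, S n w) * \esum_(v in [set: nvec d])
     (c (J n w, S n w) v * \int[q v (J n w)]_y g (S n w) v y)).
Proof.
move=> tn mf f0 mg g0 hH; have mH := history_measurable mJS hH.
(* [one_step] accepts only functions of the next state for a fixed jump, so S_n is frozen at [s] as
   well, and the result is summed over s and v. *)
pose fs s z := f z * (z.2 == s)%:R%:E.
have fs0 s z : 0 <= fs s z by rewrite mule_ge0// lee_fin.
have mfs s : measurable_fun setT (fs s).
  by apply: emeasurable_funM => //; exact: (measurable_fun_zvec_pred (fun t => t == s)).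
have mfsJ s : measurable_fun setT (fun w => fs s (J n w, S n w)).
  exact: (measurableT_comp (mfs s) (measurable_JS mJS n)).
have i0 v w s : 0 <= \int[q v (J n w)]_y g s v y by exact: integral_ge0.
have fsE w (G : zvec d -> \bar R) : (forall s, 0 <= G s) ->
    \esum_(s in [set: zvec d]) (fs s (J n w, S n w) * G s) = f (J n w, S n w) * G (S n w).
  move=> G0; rewrite (@esum_single _ _ _ (S n w)).
  - by rewrite /fs eqxx mule1.
  - by rewrite mule_ge0.
  - by move=> s sn; rewrite /fs /= eq_sym (negbTE sn) mule0 mul0e.
transitivity (\esum_(s in [set: zvec d]) \esum_(v in [set: nvec d])
  \int[P]_(w in H) (fs s (J n w, S n w) *
    (((S n.+1 w - S n w)%R == zvec_of v)%:R%:E * g s v (J n.+1 w)))).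
  have D0 w v s : 0 <= ((S n.+1 w - S n w)%R == zvec_of v)%:R%:E * g s v (J n.+1 w).
    by rewrite mule_ge0// lee_fin.
  have mD s v : measurable_fun setT (fun w => fs s (J n w, S n w) *
      (((S n.+1 w - S n w)%R == zvec_of v)%:R%:E * g s v (J n.+1 w))).
    apply: emeasurable_funM => //; apply: emeasurable_funM.
      exact: measurable_increment_indic.
    exact: (measurableT_comp (mg s v) (mJS n.+1).1).
  rewrite (_ : (fun s => \esum_(v in _) _) = fun s => \int[P]_(w in H)
    \esum_(v in [set: nvec d]) (fs s (J n w, S n w) *
    (((S n.+1 w - S n w)%R == zvec_of v)%:R%:E * g s v (J n.+1 w)))); last first.
    by apply/funext => s; rewrite integral_esum// => v w; rewrite mule_ge0.
  rewrite -integral_esum//; first last.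
  - by move=> s; apply: measurable_fun_esum => // v w; rewrite mule_ge0.
  - by move=> s w; apply: esum_ge0 => v _; rewrite mule_ge0.
  apply: eq_integral => w _.
  transitivity (\esum_(s in [set: zvec d]) (fs s (J n w, S n w) *
     \esum_(v in [set: nvec d])
       (((S n.+1 w - S n w)%R == zvec_of v)%:R%:E * g s v (J n.+1 w)))).
    rewrite fsE; last by move=> s; apply: esum_ge0.
    congr (_ * _); rewrite /after; case: zle0P => [[v Ev]|Nv].
      rewrite Ev zvec_ofK (@esum_single _ _ _ v).
      - by rewrite eqxx mul1e.
      - by rewrite mule_ge0// lee_fin.
      - move=> u uv; rewrite (_ : (_ == _) = false) ?mul0e//.
        apply/negbTE; apply: contra_neq uv => uv.
        by rewrite -(zvec_ofK v) uv zvec_ofK.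
    rewrite esum1// => v _; rewrite (_ : (_ == _) = false) ?mul0e//.
    by apply/negbTE/eqP => Ev; apply: Nv; exists v.
  by apply: eq_esum => s _; rewrite esumZl.
under eq_esum do under eq_esum do rewrite (one_step mJS c0 mc tn)//.
have C0 w s v : 0 <= c (J n w, S n w) v * \int[q v (J n w)]_y g s v y.
  by rewrite mule_ge0.
have mC s v : measurable_fun setT (fun w => fs s (J n w, S n w) *
    (c (J n w, S n w) v * \int[q v (J n w)]_y g s v y)).
  apply: emeasurable_funM => //; apply: emeasurable_funM.
    exact: (measurableT_comp (mc v) (measurable_JS mJS n)).
  exact: measurable_int_kernel.
transitivity (\esum_(s in [set: zvec d]) \int[P]_(w in H)
    \esum_(v in [set: nvec d]) (fs s (J n w, S n w) *
    (c (J n w, S n w) v * \int[q v (J n w)]_y g s v y))).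
  by apply: eq_esum => s _; rewrite integral_esum// => v w; rewrite mule_ge0.
rewrite -integral_esum//; first last.
- by move=> s; apply: measurable_fun_esum => // v w; rewrite mule_ge0.
- by move=> s w; apply: esum_ge0 => v _; rewrite mule_ge0.
apply: eq_integral => w _.
transitivity (\esum_(s in [set: zvec d]) (fs s (J n w, S n w) *
     \esum_(v in [set: nvec d]) (c (J n w, S n w) v * \int[q v (J n w)]_y g s v y))).
  by apply: eq_esum => s _; rewrite esumZl.
by rewrite fsE// => s; apply: esum_ge0.
Qed.

End OneStepSum.

(** * Renewal paths *)

Section ZVectors.
Context (d : nat).
Implicit Types (s t : zvec d) (u v k : nvec d).

Lemma zle_refl s : zle s s.
Proof. exact/zleP. Qed.

Lemma zle_trans t s r : zle s t -> zle t r -> zle s r.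
Proof. by move=> /zleP st /zleP tr; apply/zleP => j; exact: le_trans (st j) (tr j). Qed.

Lemma zle_add_nvec s v : zle s (s + zvec_of v)%R.
Proof. by apply/zleP => j; rewrite !ffunE lerDl. Qed.

Let zE s t j : (s + t)%R j = (s j + t j)%R.
Proof. by rewrite ffunE. Qed.

Let zofE v j : zvec_of v j = (v j)%:Z.
Proof. by rewrite ffunE. Qed.

Let nofE s k j : nvec_of (zvec_of k - s)%R j = `|(k j)%:Z - s j|%N.
Proof. by rewrite !ffunE. Qed.

Let nsubE u v j : nsub u v j = (u j - v j)%N.
Proof. by rewrite ffunE. Qed.

Lemma zle_split s v k : zle s (zvec_of k) ->
  zle (s + zvec_of v)%R (zvec_of k) = nle v (nvec_of (zvec_of k - s)%R).
Proof.
move=> /zleP sk; apply/zleP/nleP => svk j; have := svk j; have := sk j.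
  by rewrite zE !zofE nofE; lia.
by rewrite zE !zofE nofE; lia.
Qed.

Lemma nvec_of_split s v k : zle (s + zvec_of v)%R (zvec_of k) ->
  nvec_of (zvec_of k - (s + zvec_of v))%R = nsub (nvec_of (zvec_of k - s)%R) v.
Proof.
move=> /zleP sk; apply/ffunP => j; have := sk j.
by rewrite nsubE !nofE zE !zofE; lia.
Qed.

Lemma zle_zvec_add s k h : zle s (zvec_of k) -> zle s (zvec_of (k + h)%R).
Proof.
by move=> /zleP sk; apply/zleP => j; have := sk j; rewrite !zofE nvec_addE; lia.
Qed.

Lemma nvec_of_add s k h : zle s (zvec_of k) ->
  nvec_of (zvec_of (k + h)%R - s)%R = (nvec_of (zvec_of k - s) + h)%R.
Proof.
move=> /zleP sk; apply/ffunP => j; have := sk j.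
by rewrite nvec_addE !nofE nvec_addE zofE; lia.
Qed.

Definition increasing_path (s : nat -> zvec d) :=
  forall n, exists2 v : nvec d, v != 0%R & s n.+1 = (s n + zvec_of v)%R.

Lemma increasing_path_zle (s : nat -> zvec d) m n : increasing_path s -> (m <= n)%N ->
  zle (s m) (s n).
Proof.
move=> sI; elim: n => [|n IH]; first by rewrite leqn0 => /eqP ->; exact: zle_refl.
rewrite leq_eqVlt => /orP[/eqP ->|]; first exact: zle_refl.
rewrite ltnS => /IH mn; have [v _ ->] := sI n.
exact: zle_trans mn (zle_add_nvec _ _).
Qed.

Lemma increasing_path_sum (s : nat -> zvec d) n : increasing_path s ->
  (\sum_j s 0%N j + n%:Z <= \sum_j s n j)%R.
Proof.
move=> sI; elim: n => [|n IH]; first by rewrite addr0.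
have [v v0 ->] := sI n.
have [j vj] : exists j, v j != 0%N.
  apply/existsP; apply: contra_neqT v0 => /existsPn v0.
  by apply/ffunP => j; rewrite ffunE; apply/eqP; have := v0 j; rewrite negbK.
have -> : (\sum_j (s n + zvec_of v)%R j = \sum_j s n j + \sum_j (v j)%:Z)%R.
  by rewrite -big_split /=; apply: eq_bigr => i _; rewrite zE zofE.
have : (1 <= \sum_j (v j)%:Z)%R.
  rewrite (bigD1 j)//=; apply: (@le_trans _ _ ((v j)%:Z)); first by lia.
  by rewrite lerDl; apply: sumr_ge0.
lia.
Qed.

(** Each step raises the coordinate sum by at least 1, while [M] is all the room between [s 0] and
    [t]. *)
Lemma increasing_path_escape (s : nat -> zvec d) t : increasing_path s ->
  exists n, ~~ zle (s n) t.
Proof.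
move=> sI; pose M := (\sum_j t j - \sum_j s 0%N j)%R.
exists (`|M|%N.+1); apply/negP => /zleP st.
have := increasing_path_sum (`|M|%N.+1) sI.
have : (\sum_j s (`|M|%N.+1) j <= \sum_j t j)%R by exact: ler_sum.
by rewrite /M; lia.
Qed.

(** N + 1 is the least index that escapes; monotonicity places it beyond [n]. *)
Lemma increasing_path_last (s : nat -> zvec d) t n : increasing_path s -> zle (s n) t ->
  exists N, [/\ (n <= N)%N, zle (s N) t & ~~ zle (s N.+1) t].
Proof.
move=> sI snt; have [m sm] := increasing_path_escape t sI.
have mP : exists m, ~~ zle (s m) t by exists m.
have nm : (n < ex_minn mP)%N.
  case: ex_minnP => l sl _; rewrite ltnNge; apply: contra sl => ln.
  exact: zle_trans (increasing_path_zle sI ln) snt.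
case: ex_minnP nm => -[//|N] sN Nmin nN; exists N; split => //.
by apply/negPn/negP => /Nmin; rewrite ltnn.
Qed.

Lemma increasing_path_lastU (s : nat -> zvec d) t n N : increasing_path s ->
  zle (s N) t -> ~~ zle (s N.+1) t -> zle (s n) t = (n <= N)%N.
Proof.
move=> sI sN sN1; apply/idP/idP => [sn|nN].
  rewrite leqNgt; apply: contra sN1 => Nn.
  exact: zle_trans (increasing_path_zle sI Nn) sn.
exact: zle_trans (increasing_path_zle sI nN) sN.
Qed.

End ZVectors.

Section PathFacts.
Context (d : nat) (dO : measure_display) (Omega : measurableType dO).
Context (S : nat -> Omega -> zvec d).

Lemma supremum_nat (A : set nat) N : A N -> (forall n, A n -> (n <= N)%N) ->
  supremum 0%N A = N.
Proof.
move=> AN leN; rewrite /supremum; case: eqP => [A0|_]; first by move: AN; rewrite A0.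
have SN : supremums A N by split => [n /leN|m]; [exact|exact].
by apply: (@is_subset1_supremums _ _ A) => //; exact: xgetI SN.
Qed.

Lemma last_renewalE k w N : increasing_path (S ^~ w) ->
  zle (S N w) (zvec_of k) -> ~~ zle (S N.+1 w) (zvec_of k) ->
  last_renewal S k w = N.
Proof.
move=> sI sN sN1; apply: supremum_nat => //= n.
by rewrite (increasing_path_lastU (s := S ^~ w) n sI sN sN1).
Qed.

End PathFacts.

(** * The renewal chain *)

Section Lift.
Context (d : nat) (R : realType) (dX : measure_display) (X : measurableType dX).
Implicit Types (b : pred (zvec d)) (k : nvec d) (g : X * nvec d -> \bar R).

(* [lift b k g (J_n, S_n)] is g evaluated at (J_n, k - S_n), killed unless S_n <= k
   and [b S_n]. *)
Definition lift b k g (z : X * zvec d) : \bar R :=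
  if b z.2 && zle z.2 (zvec_of k) then g (z.1, nvec_of (zvec_of k - z.2)%R) else 0.

Lemma lift_ge0 b k g z : (forall z, 0 <= g z) -> 0 <= lift b k g z.
Proof. by move=> g0; rewrite /lift; case: ifP. Qed.

Lemma measurable_lift b k g : nneg_measurable g -> measurable_fun setT (lift b k g).
Proof.
move=> ng; apply: measurable_fun_prod_zvec => s; rewrite /lift /=.
case: (b s && _); last exact: measurable_cst.
exact: (measurable_slice _ ng).
Qed.

End Lift.

Section Chain.
Context (d : nat) (R : realType) (dX : measure_display) (X : measurableType dX).
Context (q : nvec d -> R.-ker X ~> X).
Hypothesis q0 : strict_kernel q.
Context (dO : measure_display) (Omega : measurableType dO) (P : probability Omega R).
Context (J : nat -> Omega -> X) (S : nat -> Omega -> zvec d).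
Hypothesis mJS : measurable_path J S.

Local Notation Z n w := (J n w, S n w).

Lemma measurable_fun_S2 (dU : measure_display) (U : measurableType dU) m n
    (F : zvec d -> zvec d -> Omega -> U) :
  (forall s t, measurable_fun setT (F s t)) ->
  measurable_fun setT (fun w => F (S m w) (S n w) w).
Proof.
move=> mF; apply: (@measurable_fun_countable_comp _ _ Omega U (zvec d * zvec d)%type
  (fun w => (S m w, S n w)) (fun p w => F p.1 p.2 w)) => // -[s t].
rewrite (_ : _ @^-1` _ = (S m @^-1` [set s]) `&` (S n @^-1` [set t])).
  by apply: measurableI; rewrite -[X in measurable X]setTI;
    [exact: ((mJS m).2 measurableT [set s])|exact: ((mJS n).2 measurableT [set t])].
by apply/seteqP; split => w /= [-> ->].
Qed.

Lemma measurable_S2_pred m n (p : zvec d -> zvec d -> bool) :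
  measurable_fun setT (fun w => (p (S m w) (S n w))%:R%:E : \bar R).
Proof.
apply: (@measurable_fun_S2 _ _ m n (fun s t _ => (p s t)%:R%:E)) => s t.
exact: measurable_cst.
Qed.

Lemma measurable_lift_JS b k (g : X * nvec d -> \bar R) n : nneg_measurable g ->
  measurable_fun setT (fun w => lift b k g (Z n w)).
Proof. by move=> ng; exact: (measurableT_comp (measurable_lift b k ng) (measurable_JS mJS n)). Qed.

Lemma measurable_after n (g : zvec d -> nvec d -> X -> \bar R) :
  (forall s v, measurable_fun setT (g s v)) ->
  measurable_fun setT (after J S g n).
Proof.
move=> mg; apply: (@measurable_fun_S2 _ _ n n.+1 (fun s t w => if zle 0%R (t - s)%R
   then g s (nvec_of (t - s)%R) (J n.+1 w) else 0)) => s t.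
by case: (zle _ _) => //; exact: (measurableT_comp (mg _ _) (mJS n.+1).1).
Qed.

Lemma transition_at_mul1 n : transition_at J S P n (fun z k A => q k z.1 A) ->
  transition_at J S P n (fun z k A => (fun _ _ => 1) z k * q k z.1 A).
Proof.
rewrite (_ : (fun z k A => q k z.1 A) = (fun z k A => (fun _ _ => 1) z k * q k z.1 A))//.
by apply/funext => z; apply/funext => v; apply/funext => A; rewrite mul1e.
Qed.

(** The transition law prescribes only the probabilities of increments in N^d. That they sum to 1
    rules out all other vectors of Z^d, and strictness rules out the increment 0. *)
Lemma ae_increment n (c : X * zvec d -> nvec d -> \bar R) :
  (forall z v, 0 <= c z v) -> (forall v, measurable_fun setT (c ^~ v)) ->
  transition_at J S P n (fun z v A => c z v * q v z.1 A) ->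
  (\forall w \ae P, \esum_(v in [set: nvec d]) (c (Z n w) v * q v (J n w) setT) = 1) ->
  \forall w \ae P, exists2 v : nvec d, v != 0%R & S n.+1 w = (S n w + zvec_of v)%R.
Proof.
move=> c0 mc tn aec.
have hT : history J S n setT by exact: sigma_generatedT.
have mcq v : measurable_fun setT (fun w => c (Z n w) v * q v (J n w) setT).
  apply: emeasurable_funM; first exact: (measurableT_comp (mc v) (measurable_JS mJS n)).
  exact: (measurableT_comp (measurable_kernel (q v) _ measurableT) (mJS n).1).
pose B := [set w | zle 0%R (S n.+1 w - S n w)%R].
pose C := [set w | (S n.+1 w - S n w)%R = zvec_of (0%R : nvec d)].
have indE (A : set Omega) (p : Omega -> bool) : measurable A -> (forall w, p w <-> A w) ->
    \int[P]_w ((p w)%:R%:E : \bar R) = P A.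
  move=> mA pA; rewrite -[A]setIT -integral_indic// ?setIT.
  apply: eq_integral => w _; rewrite indicE; congr ((nat_of_bool _)%:R%:E).
  by apply/idP/idP => [/pA/mem_set//|/set_mem/pA].
have mB : measurable B.
  rewrite -[B]setTI; have := @measurable_S2_pred n.+1 n (fun s t => zle 0%R (s - t)%R).
  move=> /(_ measurableT [set 1%E] (emeasurable_set1 _)); congr measurable.
  apply/seteqP; split => w /= [_ Bw]; split => //; last by rewrite Bw.
  by move: Bw; rewrite /B /=; case: (zle _ _) => // -[/eqP]; rewrite eq_sym oner_eq0.
have PB : P B = 1.
  have := one_step_sum mJS c0 mc (f := fun _ => 1) (g := fun _ _ _ => 1) tn.
  move=> /(_ setT) E; rewrite -(indE B (fun w => zle 0%R (S n.+1 w - S n w)%R))//.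
  transitivity (\int[P]_w (1 * after J S (fun _ _ _ => 1) n w)).
    by apply: eq_integral => w _; rewrite /after mul1e; case: (zle _ _).
  rewrite E//.
  transitivity (\int[P]_w (cst 1 w : \bar R)).
    apply: ae_eq_integral => //.
    - apply: emeasurable_funM => //; apply: measurable_fun_esum => [v w|v].
        by rewrite mule_ge0// integral_ge0.
      apply: eq_measurable_fun (mcq v) => w _.
      by rewrite integral_cst// mul1e.
    - apply: filterS aec => w Ew _; rewrite mul1e -[RHS]Ew.
      by apply: eq_esum => v _; rewrite integral_cst// mul1e.
  rewrite integral_cst// mul1e; exact: (probability_setT P).
have PC : P C = 0.
  have := one_step mJS c0 mc tn (f := fun _ => 1).
  move=> /(_ (measurable_cst _) (fun=> lee01) 0%R (fun _ => 1)).
  move=> /(_ (measurable_cst _) (fun=> lee01) _ hT).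
  rewrite -(indE C (fun w => (S n.+1 w - S n w)%R == zvec_of 0%R)) => [E||w]; first last.
  - by split => /eqP.
  - exact: (measurable_increment mJS).
  under eq_integral do rewrite -[_%:E]mule1 -[_ * 1]mul1e.
  rewrite E; apply: integral0_eq => w _.
  by rewrite integral_cst// mul1e q0// !mule0.
have mC : measurable C by exact: (measurable_increment mJS).
have PNB : P (~` B) = 0 by rewrite probability_setC// PB subee.
exists (~` B `|` C); split.
- by apply: measurableU => //; exact: measurableC.
- by apply: etrans PNB; apply: measureU0 => //; exact: measurableC.
move=> w /= Nw; have [Bw|] := pselect (B w); last by left.
right; move: Bw; rewrite /B /= => /zle0P[v Ev]; rewrite /C /= Ev.
have [->//|v0] := eqVneq v 0%R.
by exfalso; apply: Nw; exists v => //; rewrite -Ev addrC subrK.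
Qed.

End Chain.

Section Renewal.
Context (d : nat) (R : realType) (dX : measure_display) (X : measurableType dX).
Context (q : nvec d -> R.-ker X ~> X).
Context (dO : measure_display) (Omega : measurableType dO) (P : probability Omega R).
Context (J : nat -> Omega -> X) (S : nat -> Omega -> zvec d).
Hypothesis mJS : measurable_path J S.
Hypothesis aeS : \forall w \ae P, increasing_path (S ^~ w).

Local Notation Z n w := (J n w, S n w).

Lemma integral_increasing (H : set Omega) (f g : Omega -> \bar R) : measurable H ->
  measurable_fun setT f -> measurable_fun setT g ->
  (forall w, 0 <= f w) -> (forall w, 0 <= g w) ->
  (forall w, increasing_path (S ^~ w) -> H w -> f w = g w) ->
  \int[P]_(w in H) f w = \int[P]_(w in H) g w.
Proof.
move=> mH mf mg f0 g0 fg; apply: ge0_ae_eq_integral => //.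
- exact: measurable_funTS.
- exact: measurable_funTS.
- by apply: filterS aeS => w; exact: fg.
Qed.

(** [c'] does not depend on the jump and may differ from [c] at jumps where g vanishes. This lets
    the residual normalisation come out as a factor whenever only jumps that leave k matter. *)
Lemma integral_lift_after n (c : X * zvec d -> nvec d -> \bar R)
    (c' : X * zvec d -> \bar R) (b : pred (zvec d)) (k : nvec d)
    (f : X * nvec d -> \bar R) (g : nvec d -> nvec d -> X -> \bar R) (H : set Omega) :
  (forall z v, 0 <= c z v) -> (forall v, measurable_fun setT (c ^~ v)) ->
  transition_at J S P n (fun z v A => c z v * q v z.1 A) ->
  (forall z, 0 <= c' z) ->
  (forall z v, b z.2 -> zle z.2 (zvec_of k) ->
    c z v = c' z \/ forall y, g (nvec_of (zvec_of k - z.2)%R) v y = 0) ->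
  nneg_measurable f -> (forall u, nneg_family (g u)) -> history J S n H ->
  \int[P]_(w in H)
    (lift b k f (Z n w) * after J S (fun s => g (nvec_of (zvec_of k - s)%R)) n w) =
  \int[P]_(w in H)
    (c' (Z n w) * lift b k (fun z => f z * qsum q (g z.2) z.1) (Z n w)).
Proof.
move=> c0 mc tn c'0 cE nf ng hH.
rewrite (one_step_sum mJS c0 mc tn _ _ _ _ hH); first last.
- by move=> s v y; exact: (ng _).1.
- by move=> s v; exact: (ng _).2.
- by move=> z; apply: lift_ge0; exact: nf.1.
- exact: measurable_lift.
apply: eq_integral => w _; rewrite /lift /=.
case: ifP => [/andP[bS Sk]|_]; last by rewrite mul0e mule0.
rewrite muleCA; congr (_ * _); rewrite /qsum -esumZl//; last first.
  by move=> v; apply: integral_ge0 => y _; exact: (ng _).1.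
apply: eq_esum => v _; have [-> //|g0] := cE (Z n w) v bS Sk.
by rewrite integral0_eq ?mule0.
Qed.

Let c1 : X * zvec d -> nvec d -> \bar R := fun _ _ => 1.

(** In terms of the remaining time t - S_n, one step of the chain acts on functions as [qstep];
    jumps that overshoot t are killed on both sides. *)
Lemma integral_lift_step n t (g : X * nvec d -> \bar R) H :
  transition_at J S P n (fun z k A => q k z.1 A) -> nneg_measurable g -> history J S n H ->
  \int[P]_(w in H) lift xpredT t g (Z n.+1 w) =
  \int[P]_(w in H) lift xpredT t (qstep q g) (Z n w).
Proof.
move=> /transition_at_mul1 tn ng hH; have mH := history_measurable mJS hH.
pose G u v y := if nle v u then g (y, nsub u v) else 0.
have n1 : nneg_measurable (fun _ : X * nvec d => 1 : \bar R) by split.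
have nG u : nneg_family (G u) by exact: nneg_family_step.
have := @integral_lift_after n c1 (fun _ => 1) xpredT t (fun _ => 1) G H.
move=> /(_ (fun _ _ => lee01) (fun _ => measurable_cst _) tn (fun _ => lee01)).
move=> /(_ (fun _ _ _ _ => or_introl erefl) n1 nG hH) E.
transitivity (\int[P]_(w in H) (lift xpredT t (fun _ => 1) (Z n w) *
  after J S (fun s => G (nvec_of (zvec_of t - s)%R)) n w)).
  apply: integral_increasing => //.
  - exact: measurable_lift_JS.
  - apply: emeasurable_funM; first exact: measurable_lift_JS.
    by apply: measurable_after => // s v; exact: (nG _).2.
  - by move=> w; apply: lift_ge0; exact: ng.1.
  - move=> w; rewrite mule_ge0 ?lift_ge0// /after; case: ifP => // _.
    exact: (nG _).1.
  move=> w Sw _; have [v _ Ev] := Sw n.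
  rewrite /after Ev addrAC subrr add0r; rewrite (introT (zle0P _)); last by exists v.
  rewrite zvec_ofK /lift /=.
  have [St|St] := boolP (zle (S n w) (zvec_of t)); last first.
    rewrite mul0e ifN//; apply: contra St; exact: zle_trans (zle_add_nvec _ _).
  rewrite mul1e zle_split// /G; case: ifP => // vt.
  by rewrite nvec_of_split// zle_split.
rewrite E; apply: eq_integral => w _; rewrite mul1e /lift /=.
by case: ifP => // _; rewrite mul1e.
Qed.

(** Given the history, the next jump leaves t with probability [Hbar] at the remaining time t -
    S_n. *)
Lemma integral_lift_end n t (g : X * nvec d -> \bar R) H :
  transition_at J S P n (fun z k A => q k z.1 A) -> nneg_measurable g -> history J S n H ->
  \int[P]_(w in H) (lift xpredT t g (Z n w) * (~~ zle (S n.+1 w) (zvec_of t))%:R%:E) =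
  \int[P]_(w in H) lift xpredT t (fun z => Hbar q z.2 z.1 * g z) (Z n w).
Proof.
move=> /transition_at_mul1 tn ng hH; have mH := history_measurable mJS hH.
pose G (u v : nvec d) (y : X) : \bar R := (~~ nle v u)%:R%:E.
have nG u : nneg_family (G u) by split => [v y|v]; [rewrite /G lee_fin|exact: measurable_cst].
have := @integral_lift_after n c1 (fun _ => 1) xpredT t g G H.
move=> /(_ (fun _ _ => lee01) (fun _ => measurable_cst _) tn (fun _ => lee01)).
move=> /(_ (fun _ _ _ _ => or_introl erefl) ng nG hH) E.
transitivity (\int[P]_(w in H) (lift xpredT t g (Z n w) *
  after J S (fun s => G (nvec_of (zvec_of t - s)%R)) n w)).
  apply: integral_increasing => //.
  - apply: emeasurable_funM; first exact: measurable_lift_JS.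
    exact: (measurable_S2_pred mJS n n.+1 (fun _ s => ~~ zle s (zvec_of t))).
  - apply: emeasurable_funM; first exact: measurable_lift_JS.
    by apply: measurable_after => // s v; exact: (nG _).2.
  - by move=> w; rewrite mule_ge0 ?lee_fin// lift_ge0//; exact: ng.1.
  - move=> w; rewrite mule_ge0//; first by apply: lift_ge0; exact: ng.1.
    by rewrite /after; case: ifP => // _; exact: (nG _).1.
  move=> w Sw _; have [v _ Ev] := Sw n.
  rewrite /after Ev addrAC subrr add0r; rewrite (introT (zle0P _)); last by exists v.
  rewrite zvec_ofK /lift /=.
  have [St|St] := boolP (zle (S n w) (zvec_of t)); last by rewrite !mul0e.
  by rewrite zle_split.
rewrite E; apply: eq_integral => w _; rewrite mul1e /lift /=.
by case: ifP => // _; rewrite muleC Hbar_qsum.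
Qed.

Lemma integral_lift_iter n m t (g : X * nvec d -> \bar R) H :
  (forall i, (n <= i)%N -> transition_at J S P i (fun z k A => q k z.1 A)) ->
  nneg_measurable g -> history J S n H ->
  \int[P]_(w in H) lift xpredT t g (Z (n + m) w) =
  \int[P]_(w in H) lift xpredT t (iter m (qstep q) g) (Z n w).
Proof.
move=> tn + hH; elim: m g => [|m IH] g ng; first by rewrite addn0.
have hH' := history_le (leq_addr m n) hH.
rewrite addnS (integral_lift_step t (tn _ (leq_addr m n)) ng hH').
by rewrite iterSr; apply: IH; exact: nneg_measurable_qstep.
Qed.

(** Along an increasing path the condition says N(t) >= n, so Y_t is determined by the chain from
    its n-th renewal on. *)
Definition at_time t (g : X * nvec d -> \bar R) n w : \bar R :=
  if zle (S n w) (zvec_of t) then g (augmented J S t w) else 0.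

(** Decomposition by the number m of renewals after the n-th: only the term with n + m = N(t) is
    nonzero. *)
Lemma at_time_series n t (g : X * nvec d -> \bar R) w : (forall z, 0 <= g z) ->
  increasing_path (S ^~ w) ->
  at_time t g n w = \sum_(m <oo) (lift xpredT t g (Z (n + m) w) *
     (~~ zle (S (n + m).+1 w) (zvec_of t))%:R%:E).
Proof.
move=> g0 Sw; rewrite /at_time; case: ifPn => St.
  have [N [nN SN SN1]] := increasing_path_last (s := S ^~ w) Sw St.
  have NE := increasing_path_lastU (s := S ^~ w) _ Sw SN SN1.
  rewrite nneseries_esumT; last first.
    by move=> m; rewrite mule_ge0 ?lee_fin//; exact: lift_ge0.
  rewrite (@esum_single _ _ _ (N - n)%N).
  - rewrite subnKC// SN1 mule1 /lift /= SN /augmented /current_state /backward_rec.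
    by rewrite (last_renewalE Sw SN SN1).
  - by rewrite mule_ge0 ?lee_fin//; exact: lift_ge0.
  move=> m mN; rewrite /lift /= NE; case: ifP => mN1; last by rewrite mul0e.
  rewrite NE (_ : ((n + m).+1 <= N)%N) ?mule0//; lia.
rewrite eseries0// => m _ _; rewrite /lift /= ifN ?mul0e//.
apply: contra St; apply: zle_trans.
by apply: (increasing_path_zle (s := S ^~ w)) => //; exact: leq_addr.
Qed.

End Renewal.

(** * Measurability of the augmented field and of its past *)

Section Augmented.
Context (d : nat) (dX : measure_display) (X : measurableType dX).
Context (dO : measure_display) (Omega : measurableType dO).
Context (J : nat -> Omega -> X) (S : nat -> Omega -> zvec d).
Hypothesis mJS : measurable_path J S.

Local Notation last_at k N := [set w | zle (S N w) (zvec_of k) /\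
  forall n, (N < n)%N -> ~~ zle (S n w) (zvec_of k)].

Lemma measurable_last_at k N : measurable (last_at k N).
Proof.
rewrite (_ : last_at k N = [set w | zle (S N w) (zvec_of k)] `&`
  \bigcap_(n in [set n | (N < n)%N]) [set w | ~~ zle (S n w) (zvec_of k)]); last first.
  by apply/seteqP; split => w /= [].
apply: measurableI; first exact: (measurable_zset mJS (fun s => zle s (zvec_of k))).
apply: bigcap_measurable => [|n _]; first by exists N.+1 => /=.
exact: (measurable_zset mJS (fun s => ~~ zle s (zvec_of k))).
Qed.

Lemma last_renewal_last_at k N w : last_at k N w -> last_renewal S k w = N.
Proof.
move=> [SN nN]; apply: supremum_nat => // n /= Sn.
by rewrite leqNgt; apply: contraL Sn => /nN.
Qed.

Lemma last_renewal_0 k w : ~ (exists N, last_at k N w) -> last_renewal S k w = 0%N.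
Proof.
move=> noN; rewrite /last_renewal /supremum; case: eqP => // A0; apply: xgetPN => m [ubm _].
move/eqP/set0P : A0 => [n0 /= Sn0]; apply: noN.
pose p n := zle (S n w) (zvec_of k).
have ubp n : p n -> (n <= m)%N by move=> pn; exact: ubm.
case: (ex_maxnP (ex_intro p n0 Sn0) ubp) => N pN maxN.
by exists N; split => // n; apply: contraTN => /maxN; rewrite leqNgt.
Qed.

(** Measurability is required on all of [Omega], also where the path is not increasing. There the
    indices with S_n <= k may have no maximum, and [supremum] then returns its default 0; hence the
    extra set for i = 0. *)
Lemma measurable_last_renewal k i : measurable [set w | last_renewal S k w = i].
Proof.
rewrite (_ : [set w | _] = last_at k i `|`
  (if i == 0%N then ~` \bigcup_N last_at k N else set0)).
  apply: measurableU; first exact: measurable_last_at.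
  case: ifP => _ //; apply: measurableC; apply: bigcup_measurable => N _.
  exact: measurable_last_at.
apply/seteqP; split => w /=.
  have [[N LN]|noN] := pselect (exists N, last_at k N w).
    by rewrite (last_renewal_last_at LN) => <-; left.
  rewrite (last_renewal_0 noN) => <-; rewrite eqxx; right => -[N _ LN].
  by apply: noN; exists N.
move=> [/last_renewal_last_at //|]; case: eqP => // -> noN.
by apply: last_renewal_0 => -[N LN]; apply: noN; exists N.
Qed.

Lemma measurable_augmented k : measurable_fun setT (augmented J S k).
Proof.
apply: (@measurable_fun_countable_comp _ _ Omega (X * nvec d)%type nat
  (last_renewal S k) (fun n w => (J n w, nvec_of (zvec_of k - S n w)%R))).
  exact: measurable_last_renewal.
move=> n; apply: measurable_fun_pair; first exact: (mJS n).1.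
by move=> _ B _; exact: ((mJS n).2 measurableT [set s | B (nvec_of (zvec_of k - s)%R)]).
Qed.

Lemma past_measurable k : past J S k `<=` measurable.
Proof. by apply: sigma_generated_measurable => m _; exact: measurable_augmented. Qed.

(** The sets A with this property form a sigma-algebra, so generators Y_m in C with m <= k suffice.
    Since N(m) <= N(k) = n, such a Y_m is read off the first n steps. The condition S_0 <= 0
    guarantees that N(m) is attained. *)
Lemma past_history k A n : past J S k A -> exists2 H, history J S n H &
  forall w, increasing_path (S ^~ w) -> zle (S 0%N w) 0%R ->
    zle (S n w) (zvec_of k) -> ~~ zle (S n.+1 w) (zvec_of k) -> A w <-> H w.
Proof.
pose M := [set A : set Omega | exists2 H, history J S n H &
  forall w, increasing_path (S ^~ w) -> zle (S 0%N w) 0%R ->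
    zle (S n w) (zvec_of k) -> ~~ zle (S n.+1 w) (zvec_of k) -> A w <-> H w].
have sM : sigma_algebra setT M.
  split.
  - by exists set0 => //; exact: (@measurable0 _ (g_sigma_algebraType _)).
  - move=> B [H hH BH]; exists (~` H); first exact: sigma_generatedC.
    move=> w Sw S0 Sn Sn1; rewrite setTD /=.
    by split; apply: contra_not => /(BH w Sw S0 Sn Sn1).
  - move=> B MB; pose H i := projT1 (cid2 (MB i)).
    exists (\bigcup_i H i).
      by apply: sigma_generated_bigcup => i; rewrite /H; case: cid2.
    move=> w Sw S0 Sn Sn1; split => -[i _ Bi]; exists i => //;
      by move: Bi; rewrite /H; case: cid2 => /= Hi _ /(_ w Sw S0 Sn Sn1) [].
move=> pA; suff : M A by [].
move: A pA; apply: smallest_sub => // _ [m /= mk [C mC <-]]; rewrite setTI.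
(* The event N(m) = i involves S_{i+1}, which for i = n is outside the history. There the condition
   is dropped: S_{n+1} already leaves k, hence also m. *)
pose D i := [set w | zle (S i w) (zvec_of m)] `&`
  ((if (i == n) then setT else [set w | ~~ zle (S i.+1 w) (zvec_of m)]) `&`
  [set w | C (J i w, nvec_of (zvec_of m - S i w)%R)]).
exists (\bigcup_i (if (i <= n)%N then D i else set0)).
  apply: sigma_generated_bigcup => i; case: leqP => ni; last first.
    exact: (@measurable0 _ (g_sigma_algebraType _)).
  apply: sigma_generatedI; first exact: (@history_zset _ _ _ _ _ J S (fun s => zle s (zvec_of m))).
  apply: sigma_generatedI.
    case: eqVneq => [_|i_n]; first exact: sigma_generatedT.
    by apply: (@history_zset _ _ _ _ _ J S (fun s => ~~ zle s (zvec_of m))); rewrite ltn_neqAle i_n.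
  apply: (historyP (J := J) (S := S) (C := [set z | C (z.1, nvec_of (zvec_of m - z.2)%R)])) => //.
  have mf : measurable_fun setT (fun z : X * zvec d => (z.1, nvec_of (zvec_of m - z.2)%R)).
    apply: measurable_fun_prod_zvec => s /=; exact: pair2_measurable.
  by rewrite -[X in measurable X]setTI; exact: mf.
move=> w Sw S0 Sn Sn1.
have zmk : zle (zvec_of m) (zvec_of k).
  by apply/zleP => j; rewrite !ffunE lez_nat; exact: (nleP _ _ mk).
have S0m : zle (S 0%N w) (zvec_of m).
  by apply: zle_trans S0 _; apply/zleP => j; rewrite !ffunE.
have [N [_ SN SN1]] := increasing_path_last (s := S ^~ w) Sw S0m.
have NE := increasing_path_lastU (s := S ^~ w) _ Sw SN SN1.
have Nn : (N <= n)%N.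
  rewrite -(increasing_path_lastU (s := S ^~ w) _ Sw Sn Sn1); exact: zle_trans SN zmk.
rewrite /= /augmented /current_state /backward_rec (last_renewalE Sw SN SN1).
split => [CN|[i _]].
  exists N => //; rewrite Nn; split => //; split => //.
  by case: eqP.
case: ifP => // i_n [/= Si [Si1 Ci]]; suff <- : i = N by [].
apply/eqP; rewrite eqn_leq -NE Si /= leqNgt -NE.
case: eqVneq Si1 => [-> _|_ //].
by apply: contra Sn1 => Sn1; exact: zle_trans Sn1 zmk.
Qed.

End Augmented.

(** * The Markov property at a renewal index *)

Section RenewalMeasure.
Context (d : nat) (R : realType) (dX : measure_display) (X : measurableType dX).
Context (q : nvec d -> R.-ker X ~> X).
Context (dO : measure_display) (Omega : measurableType dO) (P : probability Omega R).
Context (J : nat -> Omega -> X) (S : nat -> Omega -> zvec d).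
Hypothesis mJS : measurable_path J S.
Hypothesis aeS : \forall w \ae P, increasing_path (S ^~ w).

Local Notation Z n w := (J n w, S n w).

Lemma measurable_at_time t (g : X * nvec d -> \bar R) n : nneg_measurable g ->
  measurable_fun setT (at_time J S t g n).
Proof.
move=> [g0 mg]; apply: (@measurable_fun_countable_comp _ _ Omega _ (zvec d) (S n)
  (fun s w => if zle s (zvec_of t) then g (augmented J S t w) else 0)) => s.
  by rewrite -[X in measurable X]setTI; exact: ((mJS n).2 measurableT [set s]).
by case: (zle _ _) => //; exact: (measurableT_comp mg (measurable_augmented mJS t)).
Qed.

Lemma at_time_ge0 t (g : X * nvec d -> \bar R) n w : (forall z, 0 <= g z) ->
  0 <= at_time J S t g n w.
Proof. by move=> g0; rewrite /at_time; case: ifP. Qed.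

(** Each term of [at_time_series] is m ordinary steps followed by an overshoot of t; integrated,
    these are exactly the terms of the series [green]. *)
Lemma integral_at_time n t (g : X * nvec d -> \bar R) H :
  (forall i, (n <= i)%N -> transition_at J S P i (fun z k A => q k z.1 A)) ->
  nneg_measurable g -> history J S n H ->
  \int[P]_(w in H) at_time J S t g n w =
  \int[P]_(w in H) lift xpredT t (green q g) (Z n w).
Proof.
move=> tn ng hH; have mH := history_measurable mJS hH.
have nHg := nneg_measurable_Hbar q ng.
have f0 m w : 0 <= lift xpredT t g (Z (n + m) w) *
    (~~ zle (S (n + m).+1 w) (zvec_of t))%:R%:E.
  by rewrite mule_ge0 ?lee_fin//; apply: lift_ge0; exact: ng.1.
have mf m : measurable_fun setT (fun w => lift xpredT t g (Z (n + m) w) *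
    (~~ zle (S (n + m).+1 w) (zvec_of t))%:R%:E).
  apply: emeasurable_funM; first exact: measurable_lift_JS.
  exact: (measurable_S2_pred mJS (n + m) (n + m).+1 (fun _ s => ~~ zle s (zvec_of t))).
transitivity (\sum_(m <oo) \int[P]_(w in H) (lift xpredT t g (Z (n + m) w) *
    (~~ zle (S (n + m).+1 w) (zvec_of t))%:R%:E)).
  rewrite -integral_nneseries//; last by move=> m; exact: measurable_funTS.
  apply: (integral_increasing aeS) => //.
  - exact: measurable_at_time.
  - apply: (@ge0_emeasurable_sum _ _ _ _ (fun m w => lift xpredT t g (Z (n + m) w) *
    (~~ zle (S (n + m).+1 w) (zvec_of t))%:R%:E) xpredT) => //.
  - by move=> w; apply: at_time_ge0; exact: ng.1.
  - by move=> w; apply: nneseries_ge0.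
  - by move=> w Sw _; apply: at_time_series => //; exact: ng.1.
transitivity (\sum_(m <oo) \int[P]_(w in H) lift xpredT t
    (iter m (qstep q) (fun z => Hbar q z.2 z.1 * g z)) (Z n w)).
  apply: eq_eseriesr => m _.
  have hH' := history_le (leq_addr m n) hH.
  rewrite (integral_lift_end mJS aeS t (tn _ (leq_addr m n)) ng hH').
  exact: (integral_lift_iter mJS aeS m t tn nHg hH).
rewrite -integral_nneseries//; first last.
- by move=> m w _; apply: lift_ge0; exact: (nneg_measurable_iter q m nHg).1.
- move=> m; apply: measurable_funTS.
  exact: (measurable_lift_JS mJS xpredT t n (nneg_measurable_iter q m nHg)).
apply: eq_integral => w _; rewrite /lift /=; case: ifP => // _.
by rewrite eseries0.
Qed.

End RenewalMeasure.

Section IntegralSetFunction.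
Context (dT : measure_display) (T : measurableType dT) (R : realType).
Import HBNNSimple.

(** An integral against a bare set function such as [Rker] uses only its values on level sets of
    simple functions, which are measurable. *)
Lemma eq_integral_setfun (mu nu : set T -> \bar R) (D : set T) (f : T -> \bar R) :
  (forall B, measurable B -> mu B = nu B) ->
  \int[mu]_(x in D) f x = \int[nu]_(x in D) f x.
Proof.
move=> munu; rewrite /integral; congr (_ - _); congr ereal_sup;
  apply/seteqP; split => _ [h hf <-]; exists h => //; rewrite /sintegral;
  by apply: eq_fsbigr => r _; rewrite munu.
Qed.

End IntegralSetFunction.

(** * The transition kernels as measures *)

Section FunctionalMeasure.
Context (dT : measure_display) (T : measurableType dT) (R : realType).

Lemma indic_bigcup_series (F : (set T)^nat) x : trivIset setT F ->
  (\1_(\bigcup_n F n) x)%:E = \sum_(n <oo) (\1_(F n) x)%:E :> \bar R.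
Proof.
move=> tF; rewrite nneseries_esumT//.
have [[i _ Fi]|nF] := pselect ((\bigcup_n F n) x).
  rewrite indicE mem_set; last by exists i.
  rewrite (@esum_single _ _ _ i)//; first by rewrite indicE mem_set.
  move=> j ji; rewrite indicE memNset// => Fj.
  by move/eqP : ji; apply; apply: tF => //; exists x.
rewrite indicE (memNset nF) esum1// => i _.
by rewrite indicE memNset// => Fi; apply: nF; exists i.
Qed.

Variable L : (T -> \bar R) -> \bar R.
Hypothesis L_ge0 : forall g, measurable_fun setT g -> (forall x, 0 <= g x) -> 0 <= L g.
Hypothesis L_mul : forall (a : R) g, (0 <= a)%R -> measurable_fun setT g ->
  (forall x, 0 <= g x) -> L (fun x => a%:E * g x) = a%:E * L g.
Hypothesis L_series : forall g : nat -> T -> \bar R,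
  (forall n, measurable_fun setT (g n)) -> (forall n x, 0 <= g n x) ->
  L (fun x => \sum_(n <oo) g n x) = \sum_(n <oo) L (g n).

Let indic_meas (A : set T) : measurable A -> measurable_fun setT (fun x => (\1_A x)%:E : \bar R).
Proof. by move=> mA; exact/measurable_EFinP/measurable_indic. Qed.

(** A positively homogeneous functional that respects countable sums is integration against a
    measure. Applied to [trans] at a fixed point, it yields countable additivity of [Rker] without
    inspecting its formula. *)
Lemma functional_measure : exists m : {measure set T -> \bar R},
  (forall B, measurable B -> m B = L (fun x => (\1_B x)%:E)) /\
  forall g, measurable_fun setT g -> (forall x, 0 <= g x) -> \int[m]_x g x = L g.
Proof.
(* A measure is a total set function here and must be nonnegative even on nonmeasurable sets; 0 is a
   default value. *)
pose mu B := if `[< measurable B >] then L (fun x => (\1_B x)%:E) else 0.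
have muE B : measurable B -> mu B = L (fun x => (\1_B x)%:E).
  by move=> mB; rewrite /mu asboolT.
have mu0 : mu set0 = 0.
  rewrite muE// (_ : (fun x => _) = fun x => (0%R)%:E * (\1_set0 x)%:E); last first.
    by apply/funext => x; rewrite indic0 mul0e.
  by rewrite L_mul ?mul0e//; exact: indic_meas.
have mu_ge0 B : 0 <= mu B.
  by rewrite /mu; case: asboolP => // mB; apply: L_ge0 => //; exact: indic_meas.
have mu_sigma : semi_sigma_additive mu.
  move=> F mF tF mUF.
  rewrite (_ : mu _ = \sum_(n <oo) mu (F n)); last first.
    rewrite muE// (_ : (fun x => _) = fun x => \sum_(n <oo) (\1_(F n) x)%:E); last first.
      by apply/funext => x; exact: indic_bigcup_series.
    rewrite L_series//; last by move=> n; exact: indic_meas.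
    by apply: eq_eseriesr => n _; rewrite muE.
  by apply: is_cvg_nneseries.
pose m : {measure set T -> \bar R} := HB.pack mu (isMeasure.Build _ _ _ mu mu0 mu_ge0 mu_sigma).
exists m; split => //; apply: ge0_measurable_ind => [A a mA a0|g mg g0 IH].
  rewrite ge0_integralZl//; last exact: indic_meas.
  by rewrite integral_indic// setIT L_mul//; [rewrite -muE|exact: indic_meas].
by rewrite integral_nneseries// L_series//; apply: eq_eseriesr => n _; exact: IH.
Qed.

End FunctionalMeasure.

Section InitialLaw.
Context (d : nat) (R : realType) (dX : measure_display) (X : measurableType dX).
Context (dO : measure_display) (Omega : measurableType dO) (P : probability Omega R).
Context (J : nat -> Omega -> X) (S : nat -> Omega -> zvec d).
Hypothesis mJS : measurable_path J S.

Lemma initial_law_integral (m : {measure set (X * zvec d) -> \bar R})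
    (g : X * zvec d -> \bar R) : initial_law J S P m ->
  measurable_fun setT g -> (forall z, 0 <= g z) ->
  \int[P]_w g (J 0%N w, S 0%N w) = \int[m]_z g z.
Proof.
move=> Pm mg g0; have mZ := measurable_JS mJS 0.
transitivity (\int[pushforward P (fun w => (J 0%N w, S 0%N w))]_z g z).
  by rewrite ge0_integral_pushforward.
by apply: eq_integral_setfun => B mB; rewrite -Pm.
Qed.

End InitialLaw.

Lemma measure_probability (dT : measure_display) (T : measurableType dT)
    (R : realType) (m : {measure set T -> \bar R}) :
  m setT = 1 -> exists p : probability T R, (p : set T -> \bar R) = m.
Proof.
move=> m1; exists (mnormalize m \d_point).
by apply/funext => B /=; rewrite /mnormalize m1 onee_eq0 /= invr1 mule1.
Qed.

(** * Representation of [green] by the laws P_y and the kernels R_h *)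

Section RenewalKernel.
Context (d : nat) (R : realType) (dX : measure_display) (X : measurableType dX).
Context (q : nvec d -> R.-ker X ~> X).
Hypotheses (q1 : total_mass_one q) (q0 : strict_kernel q).

Lemma ae_increasing_path (dO : measure_display) (Omega : measurableType dO)
    (P : probability Omega R) (S : nat -> Omega -> zvec d) :
  (forall n, \forall w \ae P, exists2 v : nvec d, v != 0%R & S n.+1 w = (S n w + zvec_of v)%R) ->
  \forall w \ae P, increasing_path (S ^~ w).
Proof. exact: ae_foralln. Qed.

Lemma ae_increment_q (dO : measure_display) (Omega : measurableType dO)
    (P : probability Omega R) (J : nat -> Omega -> X) (S : nat -> Omega -> zvec d) n :
  measurable_path J S -> transition_at J S P n (fun z k A => q k z.1 A) ->
  \forall w \ae P, exists2 v : nvec d, v != 0%R & S n.+1 w = (S n w + zvec_of v)%R.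
Proof.
move=> mJS /transition_at_mul1 tn.
apply: (ae_increment q0 mJS _ _ tn) => //.
by apply/aeW => w /=; under eq_esum do rewrite mul1e; exact: q1.
Qed.

Context (dC : measure_display) (OmegaC : measurableType dC).
Context (PC : X -> probability OmegaC R).
Context (JC : nat -> OmegaC -> X) (SC : nat -> OmegaC -> zvec d).
Hypothesis hC : forall y : X, renewal_chain_from q JC SC (PC y) y.

(** The Markov property at renewal index 0: under P_y the chain starts at (y, 0), so S_0 <= t holds
    almost surely and [at_time] imposes nothing. *)
Lemma renewal_green (g : X * nvec d -> \bar R) t y : nneg_measurable g ->
  green q g (y, t) = \int[PC y]_w g (augmented JC SC t w).
Proof.
move=> ng; have [mJS i0 tn] := hC y; have nG := nneg_measurable_green q ng.
have aeS : \forall w \ae PC y, increasing_path (SC ^~ w).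
  by apply: ae_increasing_path => n; exact: (ae_increment_q mJS (tn n)).
have hT : history JC SC 0 setT by exact: sigma_generatedT.
have E := integral_at_time mJS aeS (n := 0) t (fun i _ => tn i) ng hT.
have mL := measurable_lift xpredT t nG.
have L0 z : 0 <= lift xpredT t (green q g) z by apply: lift_ge0; exact: nG.1.
have := initial_law_integral mJS (m := \d_(y, 0%R : zvec d)) i0 mL L0.
rewrite -E integral_dirac// diracT mul1e /lift /=.
have -> : zle (0%R : zvec d) (zvec_of t) by apply/zle0P; exists t.
rewrite subr0 zvec_ofK => <-.
have S0 : PC y [set w | SC 0%N w = 0%R] = 1.
  have := i0 [set z | z.2 = 0%R].
  rewrite diracE mem_set//; apply.
  rewrite -[X in measurable X]setTI.
  exact: (@measurable_snd _ _ X (zvec d) measurableT [set 0%R]).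
have mS0 : measurable [set w | SC 0%N w = 0%R].
  by rewrite -[X in measurable X]setTI; exact: ((mJS 0%N).2 measurableT [set 0%R]).
have [g0 mg] := ng; have mA := measurable_augmented mJS t.
apply: ge0_ae_eq_integral => //.
- exact: measurable_at_time.
- exact: (measurableT_comp mg mA).
- by move=> w _; exact: at_time_ge0.
exists (~` [set w | SC 0%N w = 0%R]); split.
- exact: measurableC.
- by have := probability_setC (PC y) mS0; rewrite S0 subee// => ->.
move=> w /= Nw Sw; apply: Nw => _; rewrite /at_time Sw.
by have -> : zle (0%R : zvec d) (zvec_of t) by apply/zle0P; exists t.
Qed.

(** Inherited from the integral against P_y rather than proved through the iterates of [qstep]. *)
Lemma green_series (g : nat -> X * nvec d -> \bar R) z : (forall n, nneg_measurable (g n)) ->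
  green q (fun z => \sum_(n <oo) g n z) z = \sum_(n <oo) green q (g n) z.
Proof.
case: z => y t ng; rewrite renewal_green; last first.
  split => [z|]; first by apply: nneseries_ge0 => n _ _; exact: (ng n).1.
  apply: (@ge0_emeasurable_sum _ _ _ _ g xpredT) => [n z _ _|n _].
    exact: (ng n).1.
  exact: (ng n).2.
have [mJS _ _] := hC y; have mA := measurable_augmented mJS t.
rewrite integral_nneseries//; first last.
- by move=> n w _; exact: (ng n).1.
- by move=> n; exact: (measurableT_comp (ng n).2 mA).
by apply: eq_eseriesr => n _; rewrite renewal_green.
Qed.

Lemma green_mul (a : \bar R) (g : X * nvec d -> \bar R) z : 0 <= a -> nneg_measurable g ->
  green q (fun z => a * g z) z = a * green q g z.
Proof.
case: z => y t a0 ng; rewrite !renewal_green//; last first.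
  split => [z|]; first by rewrite mule_ge0// ng.1.
  by apply: emeasurable_funM; [exact: measurable_cst|exact: ng.2].
have [mJS _ _] := hC y; rewrite ge0_integralZl//; last by move=> w _; exact: ng.1.
exact: (measurableT_comp ng.2 (measurable_augmented mJS t)).
Qed.

Lemma trans_series h (g : nat -> X * nvec d -> \bar R) z : (forall n, nneg_measurable (g n)) ->
  trans q h (fun z => \sum_(n <oo) g n z) z = \sum_(n <oo) trans q h (g n) z.
Proof.
move=> ng; have nG n := nneg_measurable_green q (ng n).
rewrite /trans nneseries_mull ?inve_ge0 ?Hbar_ge0//; last first.
  by move=> n; exact: (nneg_measurable_jump q h (ng n)).1.
congr (_ * _); rewrite /jump nneseriesD; first last.
- by move=> n _ _; apply: qsum_ge0; exact: (nneg_family_leap z.2 h (nG n)).1.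
- by move=> n _ _; rewrite mule_ge0 ?Hbar_ge0 ?(ng n).1.
rewrite nneseries_mull ?Hbar_ge0//; last by move=> n; exact: (ng n).1.
congr (_ + _); rewrite -qsum_series; last by move=> n; exact: (nneg_family_leap z.2 h (nG n)).
apply: eq_qsum => v y; case: (_ && _); first exact: green_series.
by rewrite eseries0.
Qed.

Lemma trans_mul h (a : \bar R) (g : X * nvec d -> \bar R) z : 0 <= a -> nneg_measurable g ->
  trans q h (fun z => a * g z) z = a * trans q h g z.
Proof.
move=> a0 ng; rewrite /trans [RHS]muleCA; congr (_ * _); rewrite /jump.
have nq := nneg_family_leap z.2 h (nneg_measurable_green q ng).
rewrite ge0_muleDr; first last.
- by apply: qsum_ge0; exact: nq.1.
- by rewrite mule_ge0 ?Hbar_ge0 ?ng.1.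
rewrite muleCA; congr (_ + _); rewrite -qsumZl//.
apply: eq_qsum => v y; case: (_ && _); last by rewrite mule0.
exact: green_mul.
Qed.

Lemma nneg_measurable_indic B : measurable B ->
  nneg_measurable (fun z : X * nvec d => (\1_B z)%:E : \bar R).
Proof. by move=> mB; split => //; exact/measurable_EFinP/measurable_indic. Qed.

Lemma Kker_green t y B : measurable B ->
  Kker JC SC PC t y B = green q (fun z => (\1_B z)%:E) (y, t).
Proof.
move=> mB; rewrite renewal_green; last exact: nneg_measurable_indic.
have [mJS _ _] := hC y.
rewrite /Kker -[X in PC y X]setIT -integral_indic//.
by rewrite -[X in measurable X]setTI; exact: measurable_augmented.
Qed.

Lemma Rker_trans h z B : admissible q z -> measurable B ->
  Rker q JC SC PC h z B = trans q h (fun z => (\1_B z)%:E) z.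
Proof.
case: z => x u Ez mB; have n1 := nneg_measurable_indic mB.
have ns := nneg_family_leap u h (nneg_measurable_green q n1).
rewrite /Rker /trans /jump /= ge0_muleDr; first last.
- by apply: qsum_ge0; exact: ns.1.
- by rewrite mule_ge0 ?Hbar_ge0.
rewrite muleCA [in RHS]muleA; congr (_ + _ * _).
rewrite esum_mkcond; apply: eq_esum => v _.
case: ifPn => [|]; first by rewrite inE /= => ->; apply: eq_integral => y _; exact: Kker_green.
by rewrite notin_setE /= => /negP/negbTE ->; rewrite integral0.
Qed.

Lemma green_one z : green q (fun _ => 1) z = 1.
Proof.
case: z => y t; rewrite renewal_green; last by split.
by rewrite integral_cst// mul1e; exact: (probability_setT (PC y)).
Qed.

(** Total mass 1 is [trans1]. The mass sits on the admissible set because restricting a function to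
    that set does not change its image under [trans]. *)
Lemma Rker_measure h z : admissible q z -> exists m : probability (X * nvec d)%type R,
  [/\ m (admissible q) = 1, forall B, measurable B -> Rker q JC SC PC h z B = m B &
      forall g, nneg_measurable g -> \int[m]_z' g z' = trans q h g z].
Proof.
move=> Ez; have mE := measurable_admissible q.
have [m [mB mint]] := functional_measure (L := fun g => trans q h g z)
  (fun g mg g0 => (nneg_measurable_trans q h (conj g0 mg)).1 z)
  (fun a g a0 mg g0 => trans_mul h z (a0 : 0 <= a%:E) (conj g0 mg))
  (fun g mg g0 => trans_series h z (fun n => conj (g0 n) (mg n))).
have m1 : m setT = 1.
  rewrite mB// -(trans1 h q1 Ez green_one); congr (trans q h _ z).
  by apply/funext => w; rewrite indicT.
have [p pm] := measure_probability m1.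
have pE B : p B = m B by rewrite -[LHS]/((p : set _ -> \bar R) B) pm.
exists p; split.
- rewrite pE mB// -(trans1 h q1 Ez green_one).
  rewrite -[RHS](congr1 (fun F => F z) (trans_restrict q h (fun _ => 1))).
  congr (trans q h _ z).
  by apply/funext => w; rewrite patchE indicE; case: ifP.
- by move=> B mBB; rewrite Rker_trans// pE mB.
- move=> g [g0 mg]; rewrite -mint//; apply: eq_integral_setfun => B _; exact: pE.
Qed.

End RenewalKernel.

(** * The Markov property of the augmented field *)

Section MarkovAt.
Context (d : nat) (R : realType) (dX : measure_display) (X : measurableType dX).
Context (q : nvec d -> R.-ker X ~> X).
Context (dO : measure_display) (Omega : measurableType dO) (P : probability Omega R).
Context (J : nat -> Omega -> X) (S : nat -> Omega -> zvec d).
Hypothesis mJS : measurable_path J S.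
Hypothesis aeS : \forall w \ae P, increasing_path (S ^~ w).

Local Notation Z n w := (J n w, S n w).

(* The event N(k) = n, restricted to [b S_n]. *)
Definition straddle (b : pred (zvec d)) (k : nvec d) (n : nat) w : bool :=
  [&& b (S n w), zle (S n w) (zvec_of k) & ~~ zle (S n.+1 w) (zvec_of k)].

Lemma measurable_straddle b k n :
  measurable_fun setT (fun w => (straddle b k n w)%:R%:E : \bar R).
Proof.
exact: (measurable_S2_pred mJS n n.+1
  (fun s t => [&& b s, zle s (zvec_of k) & ~~ zle t (zvec_of k)])).
Qed.

Lemma lift_after_overshoot b k (u : nvec d) (f : X * nvec d -> \bar R) n w :
  increasing_path (S ^~ w) ->
  lift b k f (Z n w) *
    after J S (fun s v _ => (~~ nle v (nvec_of (zvec_of k - s) + u)%R)%:R%:E) n w =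
  lift b k f (Z n w) * (~~ zle (S n.+1 w) (zvec_of (k + u)%R))%:R%:E.
Proof.
move=> Sw; have [v _ Ev] := Sw n.
rewrite /after Ev addrAC subrr add0r; rewrite (introT (zle0P _)); last by exists v.
rewrite zvec_ofK /lift /=; case: ifP => [/andP[_ Sk]|_]; last by rewrite !mul0e.
by rewrite zle_split; [rewrite nvec_of_add|exact: zle_zvec_add].
Qed.

(** If S_{n+1} leaves k + h, the last renewal is still the n-th, so the state is kept and the age
    grows by h. *)
Lemma straddle_split b k h (g : X * nvec d -> \bar R) n w : (forall z, 0 <= g z) ->
  increasing_path (S ^~ w) ->
  (straddle b k n w)%:R%:E * g (augmented J S (k + h)%R w) =
  lift b k (fun z => g (z.1, (z.2 + h)%R)) (Z n w) *
    (~~ zle (S n.+1 w) (zvec_of (k + h)%R))%:R%:E +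
  (straddle b k n w)%:R%:E * at_time J S (k + h)%R g n.+1 w.
Proof.
move=> g0 Sw; rewrite /lift /straddle /= /at_time.
case: (b (S n w)); last by rewrite /= !mul0e add0e.
have [Sk|Sk] /= := boolP (zle (S n w) (zvec_of k)); last by rewrite !mul0e add0e.
have Skh := zle_zvec_add h Sk.
have [Sn1|Sn1] := boolP (zle (S n.+1 w) (zvec_of (k + h)%R)).
  by rewrite mule0 add0e.
have Sn1k : ~~ zle (S n.+1 w) (zvec_of k) by apply: contra Sn1; exact: zle_zvec_add.
rewrite Sn1k /= mul1e !mule1 mule0 adde0 /augmented /current_state /backward_rec.
by rewrite (last_renewalE Sw Skh Sn1) nvec_of_add.
Qed.

Lemma straddle_lift b k (f : X * nvec d -> \bar R) n w : increasing_path (S ^~ w) ->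
  (straddle b k n w)%:R%:E * f (augmented J S k w) =
  lift b k f (Z n w) * (~~ zle (S n.+1 w) (zvec_of k))%:R%:E.
Proof.
move=> Sw; rewrite /lift /straddle /=.
case: (b (S n w)); last by rewrite /= !mul0e.
have [Sk|Sk] /= := boolP (zle (S n w) (zvec_of k)); last by rewrite !mul0e.
have [Sn1|Sn1] := boolP (zle (S n.+1 w) (zvec_of k)); first by rewrite mul0e mule0.
rewrite mule1 mul1e /augmented /current_state /backward_rec.
by rewrite (last_renewalE Sw Sk Sn1).
Qed.

Variables (n : nat) (c : X * zvec d -> nvec d -> \bar R) (c' : X * zvec d -> \bar R).
Variables (b : pred (zvec d)) (k : nvec d).
Hypothesis c0 : forall z v, 0 <= c z v.
Hypothesis mc : forall v, measurable_fun setT (c ^~ v).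
Hypothesis c'0 : forall z, 0 <= c' z.
Hypothesis mc' : measurable_fun setT c'.
Hypothesis tn : transition_at J S P n (fun z v A => c z v * q v z.1 A).
(* Beyond time k the first, residual, step differs from an ordinary one only by a
   factor depending on the past. *)
Hypothesis cE : forall z v, b z.2 -> zle z.2 (zvec_of k) ->
  ~~ nle v (nvec_of (zvec_of k - z.2)%R) -> c z v = c' z.
Hypothesis tq : forall i, (n < i)%N -> transition_at J S P i (fun z k A => q k z.1 A).

(** Used twice: with u = h for the case without a renewal up to k + h, and with u = 0 to turn the
    indicator of N(k) = n into the factor [Hbar] at Y_k. *)
Lemma integral_overshoot u (f : X * nvec d -> \bar R) H : nneg_measurable f -> history J S n H ->
  \int[P]_(w in H) (lift b k f (Z n w) *
    (~~ zle (S n.+1 w) (zvec_of (k + u)%R))%:R%:E) =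
  \int[P]_(w in H) (c' (Z n w) *
    lift b k (fun z => f z * Hbar q (z.2 + u)%R z.1) (Z n w)).
Proof.
move=> nf hH; have mH := history_measurable mJS hH.
pose G (w v : nvec d) (y : X) : \bar R := (~~ nle v (w + u)%R)%:R%:E.
have nG w : nneg_family (G w).
  by split => [v y|v]; [rewrite /G lee_fin|exact: measurable_cst].
have := integral_lift_after mJS (b := b) (k := k) (f := f) (g := G) c0 mc tn c'0 _ nf nG hH.
have -> : (fun z => f z * qsum q (G z.2) z.1) = (fun z => f z * Hbar q (z.2 + u)%R z.1).
  by apply/funext => z; rewrite Hbar_qsum.
move=> <-; last first.
  move=> z v bz zk; have [vu|vu] := boolP (nle v (nvec_of (zvec_of k - z.2)%R)).
    by right => y; rewrite /G (nle_trans vu (nle_addr _ _)).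
  by left; exact: cE.
apply: (integral_increasing aeS) => //.
- apply: emeasurable_funM; first exact: measurable_lift_JS.
  exact: (measurable_S2_pred mJS n n.+1 (fun _ s => ~~ zle s (zvec_of (k + u)%R))).
- apply: emeasurable_funM; first exact: measurable_lift_JS.
  by apply: measurable_after => // s v; exact: (nG _).2.
- by move=> w; rewrite mule_ge0 ?lee_fin// lift_ge0//; exact: nf.1.
- move=> w; rewrite mule_ge0//; first by apply: lift_ge0; exact: nf.1.
  by rewrite /after; case: ifP => // _; exact: (nG _).1.
by move=> w Sw _; rewrite (lift_after_overshoot b k u f n Sw).
Qed.

Lemma integral_straddle_at_time h (g : X * nvec d -> \bar R) H : nneg_measurable g ->
  history J S n H ->
  \int[P]_(w in H) ((straddle b k n w)%:R%:E * at_time J S (k + h)%R g n.+1 w) =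
  \int[P]_(w in H) (c' (Z n w) * lift b k (fun z => qsum q (fun v y =>
     if nle v (z.2 + h)%R && ~~ nle v z.2
     then green q g (y, nsub (z.2 + h)%R v) else 0) z.1) (Z n w)).
Proof.
move=> ng hH; have mH := history_measurable mJS hH.
have nGr := nneg_measurable_green q ng.
pose G (u v : nvec d) (y : X) : \bar R :=
  if nle v (u + h)%R && ~~ nle v u then green q g (y, nsub (u + h)%R v) else 0.
have nG u : nneg_family (G u) by exact: nneg_family_leap.
(* The event N(k) = n is decided by S_n and S_{n+1}, so it belongs to the history at n + 1 and the
   Markov property at that renewal applies on it. *)
pose D := [set w | straddle b k n w].
have hD : history J S n.+1 D.
  rewrite (_ : D = [set w | b (S n w) && zle (S n w) (zvec_of k)] `&`
    [set w | ~~ zle (S n.+1 w) (zvec_of k)]).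
    apply: sigma_generatedI.
      exact: (@history_zset _ _ _ _ _ J S (fun s => b s && zle s (zvec_of k))).
    exact: (@history_zset _ _ _ _ _ J S (fun s => ~~ zle s (zvec_of k))).
  by apply/seteqP; split => w /=; rewrite /D /straddle /= andbA => /andP.
have hHD : history J S n.+1 (H `&` D).
  by apply: sigma_generatedI => //; exact: history_le hH.
have onD (f : Omega -> \bar R) :
    \int[P]_(w in H) ((straddle b k n w)%:R%:E * f w) = \int[P]_(w in H `&` D) f w.
  rewrite integral_mkcondr; apply: eq_integral => w _; rewrite patchE.
  case: ifPn => [|]; first by rewrite inE /D /= => ->; rewrite mul1e.
  by rewrite notin_setE /D /= => /negP/negbTE ->; rewrite mul0e.
rewrite onD (integral_at_time mJS aeS (n := n.+1) (k + h)%R tq ng hHD) -onD.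
have n1 : nneg_measurable (fun _ : X * nvec d => 1 : \bar R) by split.
have := integral_lift_after mJS (b := b) (k := k) (f := fun _ => 1) (g := G)
  c0 mc tn c'0 _ n1 nG hH.
have -> : (fun z => 1 * qsum q (G z.2) z.1) = (fun z => qsum q (G z.2) z.1).
  by apply/funext => z; rewrite mul1e.
move=> <-; last first.
  move=> z v bz zk; have [vu|vu] := boolP (nle v (nvec_of (zvec_of k - z.2)%R)).
    by right => y; rewrite /G vu andbF.
  by left; exact: cE.
apply: (integral_increasing aeS) => //.
- apply: emeasurable_funM; first exact: measurable_straddle.
  exact: measurable_lift_JS.
- apply: emeasurable_funM; first exact: measurable_lift_JS.
  by apply: measurable_after => // s v; exact: (nG _).2.
- by move=> w; rewrite mule_ge0 ?lee_fin// lift_ge0//; exact: nGr.1.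
- move=> w; rewrite mule_ge0//; first by apply: lift_ge0.
  by rewrite /after; case: ifP => // _; exact: (nG _).1.
move=> w Sw _; have [v _ Ev] := Sw n.
rewrite /after Ev addrAC subrr add0r; rewrite (introT (zle0P _)); last by exists v.
rewrite zvec_ofK /lift /straddle /= Ev.
case: (b (S n w)); last by rewrite /= !mul0e.
have [Sk|Sk] /= := boolP (zle (S n w) (zvec_of k)); last by rewrite !mul0e.
have Skh := zle_zvec_add h Sk.
rewrite mul1e zle_split// /G; case: (nle v _); first by rewrite andbF mul0e.
rewrite mul1e andbT zle_split// nvec_of_add//; case: ifP => // vuh.
by rewrite nvec_of_split ?nvec_of_add// zle_split// nvec_of_add.
Qed.

Lemma markov_at h (g f : X * nvec d -> \bar R) H : nneg_measurable g -> nneg_measurable f ->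
  (forall z, Hbar q z.2 z.1 * f z = jump q h g z) -> history J S n H ->
  \int[P]_(w in H) ((straddle b k n w)%:R%:E * g (augmented J S (k + h)%R w)) =
  \int[P]_(w in H) ((straddle b k n w)%:R%:E * f (augmented J S k w)).
Proof.
move=> ng nf fg hH; have mH := history_measurable mJS hH.
have [g0 mg] := ng; have [f0 mf] := nf.
have ngh : nneg_measurable (fun z : X * nvec d => g (z.1, (z.2 + h)%R)).
  by apply: nneg_measurable_prod => // u; exact: (measurable_slice (u + h)%R ng).
have mst := measurable_straddle b k n.
have mover t : measurable_fun setT (fun w => (~~ zle (S n.+1 w) (zvec_of t))%:R%:E : \bar R).
  exact: (measurable_S2_pred mJS n n.+1 (fun _ s => ~~ zle s (zvec_of t))).
transitivity (\int[P]_(w in H) (lift b k (fun z => g (z.1, (z.2 + h)%R)) (Z n w) *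
    (~~ zle (S n.+1 w) (zvec_of (k + h)%R))%:R%:E +
  (straddle b k n w)%:R%:E * at_time J S (k + h)%R g n.+1 w)).
  apply: (integral_increasing aeS) => //.
  - apply: emeasurable_funM => //.
    exact: (measurableT_comp mg (measurable_augmented mJS (k + h)%R)).
  - apply: emeasurable_funD; apply: emeasurable_funM => //.
      exact: measurable_lift_JS.
    exact: measurable_at_time.
  - by move=> w; rewrite mule_ge0// lee_fin.
  - by move=> w; rewrite adde_ge0 ?mule_ge0 ?lee_fin ?lift_ge0 ?at_time_ge0.
  by move=> w Sw _; exact: straddle_split.
rewrite ge0_integralD//; first last.
- apply: measurable_funTS; apply: emeasurable_funM => //; exact: measurable_at_time.
- by move=> w _; rewrite mule_ge0 ?lee_fin ?at_time_ge0.
- by apply: measurable_funTS; apply: emeasurable_funM => //; exact: measurable_lift_JS.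
- by move=> w _; rewrite mule_ge0 ?lee_fin ?lift_ge0.
rewrite integral_overshoot// integral_straddle_at_time//.
have nq : nneg_measurable (fun z : X * nvec d => qsum q (fun v y =>
     if nle v (z.2 + h)%R && ~~ nle v z.2
     then green q g (y, nsub (z.2 + h)%R v) else 0) z.1).
  apply: nneg_measurable_prod => [z|u].
    by apply: qsum_ge0; exact: (nneg_family_leap z.2 h (nneg_measurable_green q ng)).1.
  exact: (measurable_qsum q (nneg_family_leap u h (nneg_measurable_green q ng))).
have nm : nneg_measurable (fun z : X * nvec d => g (z.1, (z.2 + h)%R) * Hbar q (z.2 + h)%R z.1).
  apply: nneg_measurable_prod => [z|u]; first by rewrite mule_ge0 ?Hbar_ge0.
  apply: emeasurable_funM; first exact: (measurable_slice (u + h)%R ng).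
  exact: (measurable_Hbar q (u + h)%R).
have mc'J : measurable_fun setT (fun w => c' (Z n w)).
  exact: (measurableT_comp mc' (measurable_JS mJS n)).
rewrite -ge0_integralD//; first last.
- by apply: measurable_funTS; apply: emeasurable_funM => //; exact: measurable_lift_JS.
- by move=> w _; rewrite mule_ge0// lift_ge0//; exact: nq.1.
- by apply: measurable_funTS; apply: emeasurable_funM => //; exact: measurable_lift_JS.
- by move=> w _; rewrite mule_ge0// lift_ge0//; exact: nm.1.
(* The two contributions now add up to c' times the lift of [jump], which [fg] replaces by [Hbar]
   times f. The form u + 0 matches [integral_overshoot], read backwards to recover f(Y_k). *)
transitivity (\int[P]_(w in H) (c' (Z n w) *
    lift b k (fun z => f z * Hbar q (z.2 + 0)%R z.1) (Z n w))).
  apply: eq_integral => w _; rewrite /lift /=; case: ifP => _; last by rewrite !mule0 adde0.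
  rewrite -ge0_muleDr; first last.
  - exact: nq.1 (_, _).
  - exact: nm.1 (_, _).
  rewrite addr0; congr (_ * _); set u := nvec_of _.
  by rewrite [RHS]muleC [RHS](fg (J n w, u)) /jump/= [X in X + _]muleC.
rewrite -integral_overshoot// addr0.
apply: (integral_increasing aeS) => //.
- by apply: emeasurable_funM => //; exact: measurable_lift_JS.
- apply: emeasurable_funM => //.
  exact: (measurableT_comp mf (measurable_augmented mJS k)).
- by move=> w; rewrite mule_ge0 ?lee_fin ?lift_ge0.
- by move=> w; rewrite mule_ge0// lee_fin.
by move=> w Sw _; rewrite straddle_lift.
Qed.

End MarkovAt.

(** * The field started from an initial law on the admissible set *)

Section Delayed.
Context (d : nat) (R : realType) (dX : measure_display) (X : measurableType dX).
Context (q : nvec d -> R.-ker X ~> X).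
Hypotheses (q1 : total_mass_one q) (q0 : strict_kernel q).
Context (dO : measure_display) (Omega : measurableType dO) (P : probability Omega R).
Context (J : nat -> Omega -> X) (S : nat -> Omega -> zvec d).
Context (mu : probability (X * nvec d)%type R).
Hypothesis muE : mu (admissible q) = 1.
Hypothesis hJS : delayed_chain q J S P mu.

Local Notation Z n w := (J n w, S n w).

Let mJS : measurable_path J S.
Proof. by case: hJS. Qed.

(** As [nvec_of] takes absolute values, this recovers (x, u) from (x, -u) only for nonpositive S_0,
    a property tracked separately below. *)
Let start (z : X * zvec d) : X * nvec d := (z.1, nvec_of (- z.2)%R).

Let measurable_start : measurable_fun setT start.
Proof. by apply: measurable_fun_prod_zvec => s; rewrite /start /=; exact: pair2_measurable. Qed.

Lemma ae_start : \forall w \ae P, zle (S 0%N w) 0%R /\ admissible q (start (Z 0%N w)).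
Proof.
pose C := [set z : X * zvec d | zle z.2 0%R] `&` start @^-1` (admissible q).
have mC : measurable C.
  apply: measurableI; rewrite -[X in measurable X]setTI.
    exact: (@measurable_snd _ _ X (zvec d) measurableT [set s | zle s 0%R]).
  by apply: measurable_start => //; exact: measurable_admissible.
pose B := [set w | C (Z 0%N w)].
have mB : measurable B.
  by rewrite -[B]setTI; exact: (measurable_JS mJS 0).
have PB : P B = 1.
  have [_ i0 _ _] := hJS; rewrite (i0 C mC) -muE; congr (mu _).
  apply/seteqP; split => -[x u]; rewrite /C /start /= opprK zvec_ofK; first by case.
  by move=> Eu; split => //; apply/zleP => j; rewrite !ffunE oppr_le0.
exists (~` B); split.
- exact: measurableC.
- by have := probability_setC P mB; rewrite PB subee// => ->.
- by move=> w /=; apply: contra_not.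
Qed.

(** [c] turns q into the residual kernel, and [c'] drops the indicator. They agree at jumps leaving
    k: since S_0 = -u <= 0, such a jump also leaves u. *)
Let c (z : X * zvec d) (v : nvec d) : \bar R :=
  if nle v (start z).2 then 0 else (Hbar q (start z).2 z.1)^-1.

Let c' (z : X * zvec d) : \bar R := (Hbar q (start z).2 z.1)^-1.

Let c0 z v : 0 <= c z v.
Proof. by rewrite /c; case: ifP => _ //; rewrite inve_ge0 Hbar_ge0. Qed.

Let measurable_c' : measurable_fun setT c'.
Proof.
apply: measurable_fun_prod_zvec => s; apply: measurable_fun_inve.
  exact: (measurable_Hbar q (nvec_of (- s)%R)).
by move=> x; exact: Hbar_ge0.
Qed.

Let measurable_c v : measurable_fun setT (c ^~ v).
Proof.
apply: measurable_fun_prod_zvec => s; rewrite /c /start /=; case: (nle v _).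
  exact: measurable_cst.
apply: measurable_fun_inve; first exact: (measurable_Hbar q (nvec_of (- s)%R)).
by move=> x; exact: Hbar_ge0.
Qed.

Let transition_c : transition_at J S P 0 (fun z v A => c z v * q v z.1 A).
Proof.
have [_ _ t0 _] := hJS.
rewrite (_ : (fun z v A => c z v * q v z.1 A) =
  (fun z v A => residual q (nvec_of (- z.2)%R) v z.1 A))//.
apply/funext => z; apply/funext => v; apply/funext => A.
by rewrite /residual /c /start /=; case: ifP => _; rewrite ?mul0e// muleC.
Qed.

(** At an admissible start, which is almost sure, the residual kernel has mass [Hbar] / [Hbar] = 1;
    the later steps have the total mass of q. *)
Lemma ae_delayed_path : \forall w \ae P, increasing_path (S ^~ w).
Proof.
have [_ _ _ tq] := hJS.
apply: ae_increasing_path => -[|n]; last by apply: (ae_increment_q q1 q0 mJS); exact: tq.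
apply: (ae_increment q0 mJS c0 measurable_c transition_c).
apply: filterS ae_start => w [_ Ew].
have H0 : Hbar q (start (Z 0%N w)).2 (J 0%N w) != 0 by rewrite gt_eqF.
rewrite -[RHS](mulVe H0 (Hbar_fin _ _ q1)) {2}/Hbar [in RHS]esum_mkcond -esumZl; first last.
- by move=> v; case: ifP.
- by rewrite inve_ge0 Hbar_ge0.
apply: eq_esum => v _; rewrite /c.
have -> : (v \in [set v | ~~ nle v (start (Z 0%N w)).2]) = ~~ nle v (start (Z 0%N w)).2.
  by apply/idP/idP => [/set_mem|]; [exact|exact: mem_set].
by case: (nle v _); rewrite /= ?mul0e ?mule0.
Qed.

(** Only the residual step n = 0 needs S_0 <= 0, in order to exchange [c] for [c']. *)
Let b n : pred (zvec d) := if n is 0%N then fun s => zle s 0%R else xpredT.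

Lemma straddle_series k (x : \bar R) w : increasing_path (S ^~ w) -> zle (S 0%N w) 0%R ->
  0 <= x -> \sum_(n <oo) ((straddle S (b n) k n w)%:R%:E * x) = x.
Proof.
move=> Sw S0 x0.
have S0k : zle (S 0%N w) (zvec_of k).
  by apply: zle_trans S0 _; apply/zleP => j; rewrite !ffunE.
have [N [_ SN SN1]] := increasing_path_last (s := S ^~ w) Sw S0k.
have NE := increasing_path_lastU (s := S ^~ w) _ Sw SN SN1.
have bS n : b n (S n w) by case: n.
have strE n : straddle S (b n) k n w = (n == N).
  by rewrite /straddle bS !NE /= -ltnNge ltnS eqn_leq.
rewrite nneseries_esumT; last by move=> n; rewrite mule_ge0// lee_fin.
rewrite (@esum_single _ _ _ N).
- by rewrite strE eqxx mul1e.
- by rewrite mule_ge0// lee_fin.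
- by move=> n nN; rewrite strE (negbTE nN) mul0e.
Qed.

(** Almost surely N(k) takes exactly one value n, and on that event A may be exchanged for a set of
    the history at n. *)
Lemma integral_straddle_series k A (H : nat -> set Omega) (V : Omega -> \bar R) :
  measurable A -> (forall n, measurable (H n)) ->
  (forall n w, increasing_path (S ^~ w) -> zle (S 0%N w) 0%R ->
    zle (S n w) (zvec_of k) -> ~~ zle (S n.+1 w) (zvec_of k) -> A w <-> H n w) ->
  measurable_fun setT V -> (forall w, 0 <= V w) ->
  \int[P]_(w in A) V w =
  \sum_(n <oo) \int[P]_(w in H n) ((straddle S (b n) k n w)%:R%:E * V w).
Proof.
move=> mA mH AH mV V0.
have aeG : \forall w \ae P, increasing_path (S ^~ w) /\ zle (S 0%N w) 0%R.
  by apply: filterS2 ae_delayed_path ae_start => w Sw [].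
have msV n : measurable_fun setT (fun w => (straddle S (b n) k n w)%:R%:E * V w).
  by apply: emeasurable_funM => //; exact: (measurable_straddle (R := R) mJS (b n) k n).
have sV0 n w : 0 <= (straddle S (b n) k n w)%:R%:E * V w by rewrite mule_ge0// lee_fin.
transitivity (\sum_(n <oo) \int[P]_(w in A) ((straddle S (b n) k n w)%:R%:E * V w)).
  rewrite -integral_nneseries//; last by move=> n; exact: measurable_funTS.
  apply: ge0_ae_eq_integral => //.
  - exact: measurable_funTS.
  - apply: measurable_funTS; apply: (@ge0_emeasurable_sum _ _ _ _
     (fun n w => (straddle S (b n) k n w)%:R%:E * V w) xpredT) => //.
  - by move=> w _; exact: nneseries_ge0.
  - by apply: filterS aeG => w [Sw S0] _; rewrite straddle_series.
apply: eq_eseriesr => n _; rewrite [LHS]integral_mkcond [RHS]integral_mkcond.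
apply: ge0_ae_eq_integral => //.
- by apply/(measurable_restrictT _ _).1 => //; exact: measurable_funTS.
- by apply/(measurable_restrictT _ _).1 => //; exact: measurable_funTS.
- by move=> w _; apply: erestrict_ge0.
- by move=> w _; apply: erestrict_ge0.
apply: filterS aeG => w [Sw S0] _; rewrite !patchE.
have [st|st] := boolP (straddle S (b n) k n w); last by rewrite !mul0e; do 2!case: ifP.
move/and3P : st => [_ Sn Sn1].
have -> : (w \in A) = (w \in H n) => //.
by apply/idP/idP => /set_mem /(AH n w Sw S0 Sn Sn1) Aw; exact/mem_set.
Qed.

Lemma markov_past k h A (g f : X * nvec d -> \bar R) : nneg_measurable g -> nneg_measurable f ->
  (forall z, Hbar q z.2 z.1 * f z = jump q h g z) -> past J S k A ->
  \int[P]_(w in A) g (augmented J S (k + h)%R w) =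
  \int[P]_(w in A) f (augmented J S k w).
Proof.
move=> ng nf fg pA; have mA := past_measurable mJS pA.
pose H n := projT1 (cid2 (past_history n pA)).
have hH n : history J S n (H n) by rewrite /H; case: cid2.
have AH n : forall w, increasing_path (S ^~ w) -> zle (S 0%N w) 0%R ->
    zle (S n w) (zvec_of k) -> ~~ zle (S n.+1 w) (zvec_of k) -> A w <-> H n w.
  by rewrite /H; case: cid2.
have mH n := history_measurable mJS (hH n).
rewrite !(integral_straddle_series mA mH AH); first last.
- by move=> w; exact: ng.1.
- exact: (measurableT_comp ng.2 (measurable_augmented mJS (k + h)%R)).
- by move=> w; exact: nf.1.
- exact: (measurableT_comp nf.2 (measurable_augmented mJS k)).
apply: eq_eseriesr => n _; have [_ _ _ tq] := hJS.
have c'0 z : 0 <= c' z by rewrite /c' inve_ge0 Hbar_ge0.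
(* The residual step is n = 0; for later n both factors are the constant 1. *)
case: n => [|n].
  have cE z v : b 0 z.2 -> zle z.2 (zvec_of k) ->
      ~~ nle v (nvec_of (zvec_of k - z.2)%R) -> c z v = c' z.
    move=> /zleP z0 _ vk; rewrite /c ifN//; apply: contra vk => /nle_trans; apply.
    by apply/nleP => j; have := z0 j; rewrite !ffunE /=; lia.
  exact: (markov_at mJS ae_delayed_path c0 measurable_c c'0 measurable_c'
    transition_c cE tq ng nf fg (hH 0%N)).
have tn := transition_at_mul1 (tq n.+1 isT).
have tq' i : (n.+1 < i)%N -> transition_at J S P i (fun z k A => q k z.1 A).
  by move=> ni; apply: tq; exact: leq_trans ni.
exact: (@markov_at _ _ _ _ q _ _ P J S mJS ae_delayed_path n.+1 (fun _ _ => 1) (fun _ => 1)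
  (b n.+1) k (fun _ _ => lee01) (fun _ => measurable_cst _) (fun _ => lee01)
  (measurable_cst _) tn (fun _ _ _ _ _ => erefl) tq' h g f (H n.+1) ng nf fg (hH n.+1)).
Qed.

End Delayed.

Lemma bounded_integrable (dT : measure_display) (T : measurableType dT) (R : realType)
    (P : probability T R) (D : set T) (g : T -> \bar R) (M : R) :
  measurable D -> measurable_fun setT g -> (forall x, `|g x| <= M%:E) -> P.-integrable D g.
Proof.
move=> mD mg gM; apply: (@integrableS _ _ _ P setT) => //; apply/integrableP; split => //.
apply: (@le_lt_trans _ _ (\int[P]_x cst M%:E x)).
  by apply: ge0_le_integral => //; exact: measurableT_comp.
rewrite integral_cst// [X in _ * X](_ : _ = 1) ?mule1 ?ltry//.
exact: (probability_setT P).
Qed.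

(** * The semigroup of kernels and the conditional expectation *)

Section KernelAction.
Context (d : nat) (R : realType) (dX : measure_display) (X : measurableType dX).
Context (q : nvec d -> R.-ker X ~> X).
Hypotheses (q1 : total_mass_one q) (q0 : strict_kernel q).
Context (dC : measure_display) (OmegaC : measurableType dC).
Context (PC : X -> probability OmegaC R).
Context (JC : nat -> OmegaC -> X) (SC : nat -> OmegaC -> zvec d).
Hypothesis hC : forall y : X, renewal_chain_from q JC SC (PC y) y.

Local Notation E := (admissible q).
Local Notation Rk := (Rker q JC SC PC).

Let mE : measurable E.
Proof. exact: measurable_admissible. Qed.

Lemma Rker_comp h r : kernel_eq_on E (Rk (h + r)%R) (kernel_comp E (Rk h) (Rk r)).
Proof.
move=> z B Ez mB; have n1 := nneg_measurable_indic R mB.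
have [m [_ mB' mint]] := Rker_measure q1 q0 hC h Ez.
rewrite (Rker_trans q1 q0 hC _ Ez mB) -(trans_add h r z q0 q1 n1).
rewrite /kernel_comp (eq_integral_setfun _ _ mB') integral_mkcond -mint; last first.
  by apply: nneg_measurable_restrict => //; exact: nneg_measurable_trans.
apply: eq_integral => z' _; rewrite !patchE; case: ifPn => // /set_mem Ez'.
by rewrite (Rker_trans q1 q0 hC _ Ez' mB).
Qed.

(** For h = 0 no jump is both below u and not below u, so only the term without a renewal
    survives. *)
Lemma Rker_dirac : kernel_eq_on E (Rk 0%R) (fun z B => \d_z B).
Proof.
move=> z B Ez mB; rewrite (Rker_trans q1 q0 hC _ Ez mB) diracE.
have H0 : Hbar q z.2 z.1 != 0 by rewrite gt_eqF.
rewrite /trans /jump addr0 (@eq_qsum _ _ _ _ q _ (fun _ _ => 0)); last first.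
  by move=> v y; case: (nle v z.2).
rewrite (_ : qsum q (fun _ _ => 0) z.1 = 0) ?adde0; last first.
  by apply: esum1 => v _; rewrite integral0.
by rewrite muleA mulVe ?Hbar_fin// mul1e indicE -surjective_pairing.
Qed.

Lemma Rker_markov h : markov_kernel_on E (Rk h).
Proof.
split=> [z Ez|B mB].
  by have [m [mE1 mB _]] := Rker_measure q1 q0 hC h Ez; exists m.
have n1 := nneg_measurable_indic R mB.
apply: (@eq_measurable_fun _ _ _ _ _ (trans q h (fun z => (\1_B z)%:E))).
  by move=> z /set_mem Ez; rewrite (Rker_trans q1 q0 hC _ Ez mB).
by apply: measurable_funTS; exact: (nneg_measurable_trans q h n1).2.
Qed.

(** [trans] represents the kernel on nonnegative functions only, hence the two parts. *)
Lemma kernel_act_trans h (f : X * nvec d -> R) z (G := (EFin \o f) \_ E) :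
  E z -> measurable_fun setT G ->
  kernel_act E (Rk h) f z = trans q h G^\+ z - trans q h G^\- z.
Proof.
move=> Ez mG; have [m [_ mB mint]] := Rker_measure q1 q0 hC h Ez.
rewrite /kernel_act (eq_integral_setfun _ _ mB) integral_mkcond -/G integralE.
rewrite !mint//; split => //; [exact: measurable_funeneg|exact: measurable_funepos].
Qed.

(** Keeps both parts of a bounded function integrable, so that their images may be subtracted. *)
Lemma trans_bound h (g : X * nvec d -> \bar R) (M : R) z : E z -> nneg_measurable g ->
  (forall z, g z <= M%:E) -> trans q h g z <= M%:E.
Proof.
move=> Ez ng gM; have [m [_ _ mint]] := Rker_measure q1 q0 hC h Ez.
have [g0 mg] := ng; rewrite -mint//.
apply: (@le_trans _ _ (\int[m]_x cst M%:E x)).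
  by apply: ge0_le_integral => // x _; apply: le_trans (gM x).
rewrite integral_cst// [X in _ * X](_ : _ = 1) ?mule1//.
exact: (probability_setT m).
Qed.

Context (mu : probability (X * nvec d)%type R) (muE : mu E = 1).
Context (dO : measure_display) (Omega : measurableType dO) (P : probability Omega R).
Context (J : nat -> Omega -> X) (S : nat -> Omega -> zvec d).
Hypothesis hJS : delayed_chain q J S P mu.

Lemma augmented_cond_exp k h (f : X * nvec d -> R) :
  measurable_fun E f -> (exists M : R, forall z, E z -> (`|f z| <= M)%R) ->
  is_cond_exp P (past J S k)
    (fun w => ((f \_ E) (augmented J S (k + h)%R w))%:E)
    (fun w => ((kernel_act E (Rk h) f) \_ E) (augmented J S k w)).
Proof.
move=> mf [M0 fM0]; have [mJS _ _ _] := hJS.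
(* The bound must be nonnegative because it is also used off E, where [G] is 0. *)
pose M := `|M0|%R; pose G := (EFin \o f) \_ E.
have mG : measurable_fun setT G.
  by apply/(measurable_restrictT _ _).1 => //; exact/measurable_EFinP.
have GM z : `|G z| <= M%:E.
  rewrite /G patchE; case: ifPn => [/set_mem Ez|_]; last by rewrite abse0 lee_fin normr_ge0.
  by rewrite lee_fin (le_trans (fM0 z Ez))// ler_norm.
have absE z : `|G z| = G^\+ z + G^\- z by rewrite -[LHS]/((abse \o G) z) fune_abse.
(* The positive and negative parts are kept abstract: only nonnegativity, boundedness and the two
   difference formulas are used from here on. *)
have [Gp [Gn [[nGp GpM] [nGn GnM] actE intE]]] : exists Gp Gn, [/\
    nneg_measurable Gp /\ (forall z, Gp z <= M%:E), nneg_measurable Gn /\ (forall z, Gn z <= M%:E),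
    forall z, E z -> kernel_act E (Rk h) f z = trans q h Gp z - trans q h Gn z &
    forall (A : set Omega) (Y : Omega -> X * nvec d), \int[P]_(w in A) G (Y w) =
      \int[P]_(w in A) Gp (Y w) - \int[P]_(w in A) Gn (Y w)].
  exists G^\+, G^\-; split.
  - split; first by split => //; exact: measurable_funepos.
    by move=> z; apply: le_trans (GM z); rewrite absE leeDl.
  - split; first by split => //; exact: measurable_funeneg.
    by move=> z; apply: le_trans (GM z); rewrite absE leeDr.
  - by move=> z Ez; exact: (@kernel_act_trans h f z Ez mG).
  - by move=> A Y; rewrite [LHS]integralE; congr (_ - _);
      apply: eq_integral => w _; rewrite ?funeposE ?funenegE.
pose V g := trans q h g \_ E.
have nV g : nneg_measurable g -> nneg_measurable (V g).
  by move=> ng; apply: nneg_measurable_restrict => //; exact: nneg_measurable_trans.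
have VM g z : nneg_measurable g -> (forall z, g z <= M%:E) -> `|V g z| <= M%:E.
  move=> ng gM; rewrite gee0_abs ?(nV _ ng).1// /V patchE; case: ifPn => [/set_mem Ez|_].
    exact: trans_bound.
  by rewrite lee_fin normr_ge0.
have VE z : ((kernel_act E (Rk h) f) \_ E) z = V Gp z - V Gn z.
  have inE' (F : X * nvec d -> \bar R) : E z -> (F \_ E) z = F z.
    by move=> Ez; rewrite patchE mem_set.
  have notinE' (F : X * nvec d -> \bar R) : ~ E z -> (F \_ E) z = 0.
    by move=> Ez; rewrite patchE memNset.
  have [Ez|Ez] := pselect (E z).
    apply: etrans (inE' _ Ez) _; apply: etrans (actE z Ez) _.
    by congr (_ - _); exact: esym (inE' _ Ez).
  apply: etrans (notinE' _ Ez) _; apply: esym; apply: etrans (sube0 0).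
  by congr (_ - _); exact: (notinE' _ Ez).
have WE : (fun w => ((f \_ E) (augmented J S (k + h)%R w))%:E) =
    G \o augmented J S (k + h)%R.
  by apply/funext => w; rewrite /G /= !patchE; case: ifP.
have mA m := measurable_augmented mJS m.
have mVE : measurable_fun setT ((kernel_act E (Rk h) f) \_ E).
  rewrite (_ : _ \_ E = V Gp \- V Gn); last by apply/funext.
  by apply: emeasurable_funB; [exact: (nV _ nGp).2|exact: (nV _ nGn).2].
have mVa g : nneg_measurable g -> measurable_fun setT (fun w => V g (augmented J S k w)).
  by move=> ng; exact: (measurableT_comp (nV _ ng).2 (mA k)).
have iV g D : nneg_measurable g -> (forall z, g z <= M%:E) -> measurable D ->
    P.-integrable D (fun w => V g (augmented J S k w)).
  move=> ng gM mD; apply: (@bounded_integrable _ _ _ P D _ M) => //; first exact: mVa.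
  by move=> w; exact: VM.
split.
- exact: past_measurable.
- rewrite WE; apply: (@bounded_integrable _ _ _ P _ _ M) => //.
    exact: (measurableT_comp mG (mA _)).
  by move=> w; exact: GM.
- under eq_fun do rewrite VE.
  by apply: integrableB => //; apply: iV.
- move=> B mB.
  apply: (@sigma_generated_preimage _ Omega _ [set m : nvec d | nle m k] _ _
    (augmented J S) k (((kernel_act E (Rk h) f) \_ E) @^-1` B)); first exact: nle_refl.
  by rewrite -[X in measurable X]setTI; exact: mVE.
move=> A pA; have mAA := past_measurable mJS pA.
under eq_integral do rewrite VE.
rewrite (integralB mAA (iV _ _ nGp GpM mAA) (iV _ _ nGn GnM mAA)).
rewrite WE /= intE.
have HV g : nneg_measurable g -> forall z, Hbar q z.2 z.1 * V g z = jump q h g z.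
  by move=> ng z; rewrite /V (Hbar_restrict q (trans q h g) z) (Hbar_trans h z q1 ng).
have mk g (ng : nneg_measurable g) := markov_past q1 q0 muE hJS ng (nV g ng) (HV g ng) pA.
by congr (_ - _); apply: esym; [exact: (mk Gp nGp)|exact: (mk Gn nGn)].
Qed.

End KernelAction.

Local Close Scope ereal_scope.

Theorem theorem7p1 (d : nat) (hd : (0 < d)%N) (R : realType)
  (dX : measure_display) (X : measurableType dX) (hX : standard_borel R X)
  (q : nvec d -> R.-ker X ~> X)
  (hq : total_mass_one q) (hstrict : strict_kernel q)
  (dC : measure_display) (OmegaC : measurableType dC)
  (PC : X -> probability OmegaC R)
  (JC : nat -> OmegaC -> X) (SC : nat -> OmegaC -> zvec d)
  (hC : forall y : X, renewal_chain_from q JC SC (PC y) y) :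
  let E := admissible q in
  let Rk := Rker q JC SC PC in
  (forall (mu : probability (X * nvec d)%type R), mu E = 1%E ->
   forall (dO : measure_display) (Omega : measurableType dO)
     (P : probability Omega R)
     (J : nat -> Omega -> X) (S : nat -> Omega -> zvec d),
   delayed_chain q J S P mu ->
   forall (k h : nvec d) (f : X * nvec d -> R),
   measurable_fun E f ->
   (exists M : R, forall z, E z -> `|f z| <= M) ->
   is_cond_exp P (past J S k)
     (fun w => ((f \_ E) (augmented J S (k + h) w))%:E)
     (fun w => ((kernel_act E (Rk h) f) \_ E) (augmented J S k w)))
  /\ [/\ forall h : nvec d, markov_kernel_on E (Rk h),
         kernel_eq_on E (Rk 0) (fun z B => \d_z B) &
         forall h r : nvec d,
           kernel_eq_on E (Rk (h + r)) (kernel_comp E (Rk h) (Rk r))]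
  /\ (forall i j : 'I_d,
        kernel_eq_on E
          (kernel_comp E (Rk (unit_vec i)) (Rk (unit_vec j)))
          (kernel_comp E (Rk (unit_vec j)) (Rk (unit_vec i)))).
Proof.
move=> E Rk; split; last split; first last.
- move=> i j z B Ez mB.
  have Rij := Rker_comp hq hstrict hC (unit_vec i) (unit_vec j) Ez mB.
  have Rji := Rker_comp hq hstrict hC (unit_vec j) (unit_vec i) Ez mB.
  apply: etrans (esym Rij) (etrans _ Rji).
  exact: (congr1 (fun v => Rker q JC SC PC v z B) (addrC (unit_vec i) (unit_vec j))).
- split=> [h||h r]; [exact: Rker_markov|exact: Rker_dirac|exact: Rker_comp].
- move=> mu muE dO Omega P J S hJS k h f mf bf.
  exact: (augmented_cond_exp hq hstrict hC muE hJS).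
Qed.
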